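(* Let $\mathcal{H}$ be a complex Hilbert space. For $T\in\mathcal{B}(\mathcal{H})$ the following statements are equivalent: (i) $T$ has a $2$-isometric lifting of type II on a Hilbert space containing $\mathcal{H}$; (ii) $T$ is an $A$-contraction for a positive operator $A\ne0$ on $\mathcal{H}$ with $\Delta_T\le A$; (iii) $T$ has a lifting $T_*$ on some $\mathcal{H}_*\supset\mathcal{H}$ which is a $B$-isometry for some $B\in\mathcal{B}(\mathcal{H}_* )$ with $0\ne B\ge0$, such that $\Delta_{T_*}\le B$ and $B\mathcal{H}\subset\mathcal{H}$; (iv) $T$ has a $2$-isometric lifting $S$ on some $\mathcal{K}\supset\mathcal{H}$, with matrix $S=\begin{pmatrix}W&X\\0&T\end{pmatrix}$ on $\mathcal{K}=\mathcal{H}^\perp\oplus\mathcal{H}$, whose entries $W$ and $X$ satisfy $$X^*\Delta_WX+2\,{\rm Re}(X^*W^*XT)\ge0.$$ Moreover, if these statements are true, then the lifting $S$ in (i) and (iv) can be chosen either minimal, or with $\Delta_{S|_{\mathcal{H}^\perp}}=2P$, where $P$ is an orthogonal projection, with shifts on the main diagonal of $S|_{\mathcal{H}^\perp}$ in its canonical representation and with ${\rm cov}(S)=\sqrt2\cdot\max\{1,\|A\|^{1/2}\}$ for $A$ from (ii).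
   Context: All Hilbert spaces are complex and operators are bounded and linear. $\Delta_T=T^*T-I$, ${\rm Re}(Y)=\frac12(Y+Y^* )$. $S$ is a $2$-isometry if $S^{*2}S^2-2S^*S+I=0$, i.e. $S^*\Delta_SS=\Delta_S$; then $\Delta_S\ge0$ and ${\rm cov}(S)=\|\Delta_S\|^{1/2}$ is its covariance. The canonical representation of a $2$-isometry $W$ on a space $\mathcal{L}$ is its block matrix $W=\begin{pmatrix}V&E\\0&Y\end{pmatrix}$ on $\mathcal{L}=\mathcal{N}(\Delta_W)\oplus\overline{\mathcal{R}(\Delta_W)}$ (here $V$ is an isometry and $V^*E=0$); its main diagonal consists of $V$ and $Y$. A shift is a pure isometry, i.e. an isometry with no nonzero reducing subspace on which it is unitary. If $\mathcal{H}$ is a closed subspace of $\mathcal{K}$, $S\in\mathcal{B}(\mathcal{K})$ is a lifting of $T\in\mathcal{B}(\mathcal{H})$ if $P_{\mathcal{H}}S=TP_{\mathcal{H}}$; equivalently $S=\begin{pmatrix}W&X\\0&T\end{pmatrix}$ on $\mathcal{K}=\mathcal{H}^\perp\oplus\mathcal{H}$ with $W=S|_{\mathcal{H}^\perp}$ (a $2$-isometry when $S$ is one) and $X=P_{\mathcal{H}^\perp}S|_{\mathcal{H}}$. It is minimal if $\mathcal{K}=\bigvee_{n\ge0}S^n\mathcal{H}$. A $2$-isometric lifting $S$ of $T$ is of type II if $S^*S\mathcal{H}\subset\mathcal{H}$. For $A\ge0$, $T$ is an $A$-contraction if $T^*AT\le A$ and an $A$-isometry if $T^*AT=A$. *)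

(* Defs.v *)
From HB Require Import structures.
From mathcomp Require Import all_boot all_order all_algebra.
From mathcomp Require Import all_classical all_reals all_analysis.
From mathcomp Require Import complex.
From mathcomp Require Import ring lra.

Set Implicit Arguments.
Unset Strict Implicit.
Unset Printing Implicit Defensive.

Import Order.TTheory GRing.Theory Num.Theory.
Import numFieldNormedType.Exports.

Local Open Scope classical_set_scope.
Local Open Scope ring_scope.

(* [inner] is linear in its first argument and conjugate linear in the second
   one. *)
HB.mixin Record CompleteNormedModule_isHilbert (R : realType) V
    & CompleteNormedModule R[i] V := {
  inner : {dot V for (@Num.conj R[i])} ;
  inner_normE : forall x : V, inner x x = `|x| ^+ 2
}.

#[short(type="hilbertType")]
HB.structure Definition Hilbert (R : realType) :=
  {V of CompleteNormedModule R[i] V & CompleteNormedModule_isHilbert R V}.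

HB.structure Definition BoundedOp (K : numFieldType) (U V : normedModType K) :=
  {f of @GRing.Linear K U V *:%R f & @isContinuous U V f}.

Notation "{ 'bounded' U -> V }" := (BoundedOp.type U V)
  (at level 0, U at level 98, V at level 99,
   format "{ 'bounded'  U  ->  V }") : type_scope.

Section bounded_instances.
Variables (K : numFieldType) (U V : normedModType K).
Variables (f g : {bounded U -> V}) (a : K).

Let add_cts : continuous (f \+ g).
Proof. by move=> x; apply: cvgD; exact: cts_fun. Qed.
HB.instance Definition _ := isContinuous.Build U V (f \+ g) add_cts.

Let sub_cts : continuous (f \- g).
Proof. by move=> x; apply: cvgB; exact: cts_fun. Qed.
HB.instance Definition _ := isContinuous.Build U V (f \- g) sub_cts.

Let scale_cts : continuous (a \*: f).
Proof. by move=> x; apply: cvgZr; exact: cts_fun. Qed.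
HB.instance Definition _ := isContinuous.Build U V (a \*: f) scale_cts.

End bounded_instances.

Section bounded_comp.
Variables (K : numFieldType) (U V W : normedModType K).
Variables (g : {bounded V -> W}) (f : {bounded U -> V}).

HB.instance Definition _ := Continuous.on (g \o f).
HB.instance Definition _ := Continuous.on (@idfun U).

End bounded_comp.

Section inner_linear.
Variables (R : realType) (H : hilbertType R).
Implicit Types (x y z : H) (a : R[i]).

Lemma innerDl x y z : inner (x + y) z = inner x z + inner y z.
Proof. exact: linearDl. Qed.
Lemma innerBl x y z : inner (x - y) z = inner x z - inner y z.
Proof. exact: linearBl. Qed.
Lemma innerZl a x z : inner (a *: x) z = a * inner x z.
Proof. exact: linearZl_LR. Qed.
Lemma inner0l z : inner 0 z = 0. Proof. exact: linear0l. Qed.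
Lemma innerDr x y z : inner x (y + z) = inner x y + inner x z.
Proof. exact: linearDr. Qed.
Lemma innerBr x y z : inner x (y - z) = inner x y - inner x z.
Proof. exact: linearBr. Qed.
Lemma innerZr a x z : inner x (a *: z) = a^* * inner x z.
Proof. exact: linearZr_LR. Qed.
Lemma inner0r z : inner z 0 = 0. Proof. exact: linear0r. Qed.

End inner_linear.

Section real_norm.
Variables (R : realType) (H : hilbertType R).
Implicit Types (x y z : H) (t : R).

(* The norm of a normed module over [R[i]] takes its values in [R[i]]. *)
Definition hnorm x : R := complex.Re `|x|.

Let ip x y : R := complex.Re (inner x y).

Lemma ltr0c t : (0 < t%:C%C :> R[i]) = (0 < t).
Proof. exact: (ltcR 0 t). Qed.

Lemma hnormE x : `|x| = (hnorm x)%:C%C.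
Proof. by rewrite /hnorm RRe_real// ger0_real. Qed.

Lemma hnorm_ge0 x : 0 <= hnorm x.
Proof. by rewrite -ler0c -hnormE. Qed.

Lemma hnorm0_eq0 x : hnorm x = 0 -> x = 0.
Proof. by move=> x0; apply/eqP; rewrite -normr_eq0 hnormE x0. Qed.

Lemma ler_hnormD x y : hnorm (x + y) <= hnorm x + hnorm y.
Proof. by rewrite -lecR rmorphD/= -!hnormE ler_normD. Qed.

Lemma innerC x y : inner x y = (inner y x)^*.
Proof. by rewrite hermC expr0 mul1r. Qed.

Lemma ReJ (c : R[i]) : complex.Re (c^*) = complex.Re c.
Proof. by case: c. Qed.

Lemma ReD (c d : R[i]) : complex.Re (c + d) = complex.Re c + complex.Re d.
Proof. by case: c; case: d. Qed.

Lemma ReM (c : R[i]) t : complex.Re (t%:C%C * c) = t * complex.Re c.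
Proof. by case: c => a b /=; rewrite mul0r subr0. Qed.

Lemma Re_innerC x y : complex.Re (inner x y) = complex.Re (inner y x).
Proof. by rewrite innerC ReJ. Qed.

Lemma Re_innerxx x : complex.Re (inner x x) = hnorm x ^+ 2.
Proof. by rewrite inner_normE hnormE -rmorphXn. Qed.

Lemma Re_innerDl x y z : ip (x + y) z = ip x z + ip y z.
Proof. by rewrite /ip linearDl ReD. Qed.

Lemma Re_innerZl t x z : ip (t%:C%C *: x) z = t * ip x z.
Proof. by rewrite /ip linearZl_LR ReM. Qed.

Lemma hnormD2 x y :
  hnorm (x + y) ^+ 2 = hnorm x ^+ 2 + 2 * complex.Re (inner x y) + hnorm y ^+ 2.
Proof.
rewrite -!Re_innerxx -![complex.Re _]/(ip _ _) Re_innerDl.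
rewrite [ip x (x + y)]Re_innerC [ip y (x + y)]Re_innerC -!/(ip _ _) !Re_innerDl.
rewrite [ip y x]Re_innerC -/(ip x y); ring.
Qed.

Lemma hnormZ t x : hnorm (t%:C%C *: x) = `|t| * hnorm x.
Proof.
have tE : `|t%:C%C| = (`|t|)%:C%C :> R[i].
  by rewrite normc_def/= expr0n addr0 sqrtr_sqr.
by rewrite {1}/hnorm normrZ tE ReM.
Qed.

Lemma discriminant_le (a b d : R) : 0 <= d ->
  (forall t, 0 <= a + 2 * t * b + t ^+ 2 * d) -> b ^+ 2 <= a * d.
Proof.
rewrite le_eqVlt => /predU1P[<-|d0] abd.
  have [->|b0] := eqVneq b 0; first by rewrite expr0n mulr0.
  have := abd (- (a + 1) / (2 * b)).
  rewrite (_ : 2 * _ * b = - (a + 1)); last by field.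
  rewrite mulr0; lra.
have := abd (- b / d).
rewrite (_ : _ + _ = (a * d - b ^+ 2) / d); last by field; lra.
by rewrite pmulr_lge0 ?invr_gt0// subr_ge0.
Qed.

Lemma CauchySchwarz_Re x y :
  `|complex.Re (inner x y)| <= hnorm x * hnorm y.
Proof.
rewrite -ler_sqr ?nnegrE ?mulr_ge0 ?hnorm_ge0// real_normK ?num_real// exprMn.
apply: discriminant_le => [|t]; first exact: sqr_ge0.
have := sqr_ge0 (hnorm (x + t%:C%C *: y)).
rewrite hnormD2 hnormZ exprMn real_normK ?num_real// Re_innerC.
rewrite -[complex.Re _]/(ip _ _) Re_innerZl /ip Re_innerC; lra.
Qed.

End real_norm.


Section riesz.
Variables (R : realType) (H : hilbertType R).
Variables (phi : {linear H -> R[i] | *%R}) (M : R).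
Hypothesis phiM : forall x, complex.Re (phi x) <= M * hnorm x.
Implicit Types (x y z : H) (t e : R).

Let F x : R := hnorm x ^+ 2 - 2 * complex.Re (phi x).

Let FD t x y : F (y + t%:C%C *: x) =
  F y + 2 * t * (complex.Re (inner x y) - complex.Re (phi x))
      + t ^+ 2 * hnorm x ^+ 2.
Proof.
rewrite /F hnormD2 hnormZ exprMn real_normK ?num_real//.
have -> : phi (y + t%:C%C *: x) = phi y + t%:C%C * phi x.
  by rewrite linearD linearZ.
rewrite ReD ReM [complex.Re (inner y _)]Re_innerC.
rewrite linearZl_LR ReM; ring.
Qed.

Let has_inf_F : has_inf (range F).
Proof.
split; first by exists (F 0), 0.
exists (- M ^+ 2) => _ [x _ <-]; rewrite /F.
have := phiM x; have := sqr_ge0 (hnorm x - M); lra.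
Qed.

Let m := inf (range F).

Let F_ge x : m <= F x.
Proof. by apply: ge_inf; [case: has_inf_F|exists x]. Qed.

Let A e : set H := [set x | F x < m + e].

Let A_neq0 e : 0 < e -> A e !=set0.
Proof.
by move=> e0; have [_ [x _ <-]] := inf_adherent e0 has_inf_F; exists x.
Qed.

Let A_near e x y : A e x -> A e y -> hnorm (x - y) ^+ 2 <= 4 * e.
Proof.
rewrite /A/= => Ax Ay; have := F_ge (y + (2^-1)%:C%C *: (x - y)); rewrite FD.
have := FD 1 (x - y) y.
rewrite (_ : 1%:C%C = 1 :> R[i])// scale1r (addrC y) subrK; lra.
Qed.

Let A_min e x y : A e y ->
  (complex.Re (inner x y) - complex.Re (phi x)) ^+ 2 <= e * hnorm x ^+ 2.
Proof.
rewrite /A/= => Ay; apply: discriminant_le => [|t]; first exact: sqr_ge0.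
by have := F_ge (y + t%:C%C *: x); rewrite FD; lra.
Qed.

Let G := filter_from [set e : R | 0 < e] A.

#[local] Instance G_filter : ProperFilter G.
Proof.
apply: filter_from_proper => [|e e0]; last exact: A_neq0.
apply: filter_from_filter => [|e d e0 d0]; first by exists 1 => /=.
exists (Num.min e d) => /=; first by rewrite lt_min e0 d0.
by move=> x; rewrite /A/= -ltrBlDl lt_min => /andP[]; rewrite !ltrBlDl.
Qed.

Let G_cauchy : cauchy G.
Proof.
apply: cauchy_exP => e e0; have eE : e = (complex.Re e)%:C%C.
  by rewrite RRe_real// gtr0_real.
move: e0; rewrite eE; move: (complex.Re e) => {eE}e; rewrite ltr0c => e0.
have d0 : 0 < (e / 4) ^+ 2 by rewrite exprn_gt0// divr_gt0.
have [x Ax] := A_neq0 d0; exists x; exists ((e / 4) ^+ 2) => // y Ay.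
rewrite -ball_normE/= hnormE ltcR -(@ltr_pXn2r _ 2) ?nnegrE ?hnorm_ge0 ?ltW//.
apply: le_lt_trans (A_near Ax Ay) _; have := exprn_gt0 2 e0; lra.
Qed.

Lemma riesz : exists z, forall x, phi x = inner x z.
Proof.
pose z : H := lim G.
have Gz : G --> z by apply: cauchy_cvg; exact: G_cauchy.
have re x : complex.Re (phi x) = complex.Re (inner x z).
  apply/eqP; rewrite eq_sym -subr_eq0 -normr_le0; apply/ler_addgt0Pl => e e0.
  rewrite addr0; pose d : R := e / (2 * (hnorm x + 1)).
  have x0 := hnorm_ge0 x.
  have d0 : 0 < d by rewrite divr_gt0// mulr_gt0//; lra.
  have [|c c0 Acz] := fcvg_ball Gz (eps := d%:C%C); first by rewrite ltr0c.
  have [y Ay] : A (Num.min c (d ^+ 2)) !=set0.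
    by apply: A_neq0; rewrite lt_min c0 exprn_gt0.
  have zy : hnorm (z - y) < d.
    rewrite -ltcR -hnormE; suff : ball z d%:C%C y by rewrite -ball_normE.
    by apply: Acz; move: Ay; rewrite /A/= -!ltrBlDl lt_min => /andP[].
  have : `|complex.Re (inner x y) - complex.Re (phi x)| <= d * hnorm x.
    rewrite -ler_sqr ?nnegrE ?(mulr_ge0 (ltW d0))// real_normK ?num_real//.
    rewrite exprMn; apply: A_min.
    by move: Ay; rewrite /A/= -!ltrBlDl lt_min => /andP[].
  have := CauchySchwarz_Re x (z - y); rewrite linearB/=.
  have -> : complex.Re (inner x z - inner x y) =
    complex.Re (inner x z) - complex.Re (inner x y).
    by case: (inner x z) => ? ?; case: (inner x y).
  have : hnorm x * hnorm (z - y) <= d * hnorm x.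
    by rewrite mulrC ler_wpM2r// ltW.
  have : d * (2 * (hnorm x + 1)) = e by rewrite divfK//; lra.
  have := ler_distD (complex.Re (inner x y)) (complex.Re (inner x z))
    (complex.Re (phi x)).
  lra.
exists z => x; apply/eqP; rewrite eq_complex re eqxx/=.
have := re ('i%C *: x); rewrite linearZ/= linearZl_LR.
rewrite (mulrC 'i%C (phi x)) (mulrC 'i%C (inner x z)) !ReiNIm.
by move=> /oppr_inj ->.
Qed.

End riesz.

Section bounded_hnorm.
Variables (R : realType) (H K : hilbertType R).

Lemma bounded_hnormP (f : {linear H -> K}) :
  (exists2 M, 0 <= M & forall x, hnorm (f x) <= M * hnorm x) <-> continuous f.
Proof.
rewrite -linear_bounded_continuous; split=> [[M M0 fM]|].
  apply/bounded_funP => r; exists (M%:C%C * r) => x xr; rewrite hnormE.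
  rewrite (@le_trans _ _ (M%:C%C * `|x|)) ?ler_wpM2l ?ler0c//.
  by rewrite hnormE -rmorphM lecR.
move=> /linear_boundedP/pinfty_ex_gt0[M M0 fM]; exists (complex.Re M).
  by rewrite -ler0c RRe_real ?ltW// gtr0_real.
move=> x; rewrite -lecR rmorphM/= -!hnormE RRe_real ?gtr0_real//; exact: fM.
Qed.

End bounded_hnorm.

Section adjoint.
Variables (R : realType) (H K : hilbertType R).

Lemma inner_ext (y z : H) : (forall x, inner x y = inner x z) -> y = z.
Proof.
move=> yz; apply/eqP; rewrite -subr_eq0 -(@dnorm_eq0 _ _ inner).
by rewrite linearB/= yz subrr.
Qed.

Variable f : {bounded H -> K}.

(* By [adjP], the set below is a singleton: the default value of [get] is never
   used. *)
Definition adj (y : K) : H := get [set z | forall x, inner (f x) y = inner x z].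

Lemma adjP x y : inner (f x) y = inner x (adj y).
Proof.
pose phi x := inner (f x) y.
have phi_lin : linear_for *%R phi.
  by move=> a u v; rewrite /phi linearP linearPl.
have [M M0 fM] := (bounded_hnormP f).2 cts_fun.
pose philin := GRing.isLinear.Build _ _ _ _ phi phi_lin.
pose Phi : {linear H -> R[i] | *%R} := HB.pack phi philin.
have [|z zP] := @riesz R H Phi (M * hnorm y).
  move=> u; apply: le_trans (ler_norm _) _.
  apply: le_trans (CauchySchwarz_Re _ _) _.
  by rewrite mulrAC ler_wpM2r ?hnorm_ge0 ?fM.
apply: (getPex (P := [set z | forall x, inner (f x) y = inner x z])).
by exists z => u; exact: (zP u).
Qed.

Let adj_linear : linear adj.
Proof.
move=> a u v; apply: inner_ext => x.
rewrite -adjP !linearDr !linearZr_LR/= -!adjP.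
by [].
Qed.

HB.instance Definition _ := GRing.isLinear.Build _ _ _ _ adj adj_linear.

Let adj_continuous : continuous adj.
Proof.
apply: (bounded_hnormP adj).1; have [M M0 fM] := (bounded_hnormP f).2 cts_fun.
exists M => // y; have [->|y0] := eqVneq (hnorm (adj y)) 0.
  by rewrite mulr_ge0 ?hnorm_ge0.
have {}y0 : 0 < hnorm (adj y) by rewrite lt_def y0 hnorm_ge0.
rewrite -(ler_pM2r y0) -expr2 -Re_innerxx -adjP.
apply: le_trans (ler_norm _) _; apply: le_trans (CauchySchwarz_Re _ _) _.
by rewrite mulrAC ler_wpM2r ?hnorm_ge0 ?fM.
Qed.

HB.instance Definition _ := isContinuous.Build K H adj adj_continuous.

End adjoint.

Record closed_subspace (R : realType) (H : hilbertType R) := ClosedSubspace {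
  subspace_set :> set H ;
  subspace_set0 : subspace_set 0 ;
  subspace_setP : forall a x y,
    subspace_set x -> subspace_set y -> subspace_set (a *: x + y) ;
  subspace_set_closed : closed subspace_set
}.

Section subspace_hilbert.
Variables (R : realType) (H : hilbertType R) (M : closed_subspace H).

Definition mem_subspace : {pred H} := fun x => x \in (M : set H).

Let mem_subspace_submod : submod_closed mem_subspace.
Proof.
split=> [|a x y]; rewrite /in_mem/= /mem_subspace !inE; first exact: subspace_set0.
exact: subspace_setP.
Qed.
HB.instance Definition _ :=
  GRing.isSubmodClosed.Build R[i] H mem_subspace mem_subspace_submod.

Definition subspace_type : Type := {x : H | mem_subspace x}.
HB.instance Definition _ := SubChoice.on subspace_type.
HB.instance Definition _ :=
  [SubChoice_isSubLmodule of subspace_type by <:].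

Let norm (u : subspace_type) : R[i] := `|val u|.
Let normD u v : norm (u + v) <= norm u + norm v.
Proof. exact: ler_normD. Qed.
Let normZ (a : R[i]) u : norm (a *: u) = `|a| * norm u.
Proof. exact: normrZ. Qed.
Let norm0 u : norm u = 0 -> u = 0.
Proof. by move=> /normr0_eq0 u0; apply: val_inj; rewrite u0. Qed.
HB.instance Definition _ :=
  Lmodule_isNormed.Build R[i] subspace_type normD normZ norm0.

Let complete (F : set_system subspace_type) :
  ProperFilter F -> cauchy F -> cvg F.
Proof.
move=> FF /cauchy_ballP F_cauchy.
have vF_cauchy : cauchy (val @ F : set_system H).
  apply/cauchy_ballP => e e0; have := F_cauchy e e0.
  move=> [[P Q] [FP FQ] PQ]; exists (val @` P, val @` Q) => /=.
    split; first by apply: filterS FP => u Pu; exists u.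
    by apply: filterS FQ => u Qu; exists u.
  move=> [_ _] /= [[u Pu <-] [v Qv <-]]; have := PQ (u, v) (conj Pu Qv).
  by rewrite /= -!ball_normE.
pose z : H := lim (val @ F).
have Fz : val @ F --> z by apply: cauchy_cvg; exact: vF_cauchy.
have Mz : mem_subspace z.
  rewrite /mem_subspace; apply/mem_set.
  have FM : \forall u \near F, subspace_set M (val u).
    by apply: filterE => u; have := valP u; rewrite /mem_subspace inE.
  exact: (closed_cvg (subspace_set M) (@subspace_set_closed _ _ M) FM z Fz).
apply/cvg_ex; exists (Sub z Mz : subspace_type); apply/fcvg_ballP => e e0.
have FB : F (val @^-1` ball z e) by exact: (fcvg_ball Fz e0).
suff sub : val @^-1` ball z e `<=` ball (Sub z Mz : subspace_type) e.
  exact: (@filterS _ F _ _ _ sub FB).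
by move=> u /=; rewrite -!ball_normE.
Qed.
HB.instance Definition _ := Uniform_isComplete.Build subspace_type complete.

Definition subspace_inner (u v : subspace_type) : R[i] :=
  inner (val u) (val v).

Let subspace_inner_bilinear :
  bilinear_for *%R (Num.conj \; *%R) subspace_inner.
Proof.
split=> [w a u v|w a u v]; rewrite /subspace_inner/=.
  by rewrite linearPl.
by rewrite linearDr linearZr_LR.
Qed.
HB.instance Definition _ := @bilinear_isBilinear.Build R[i] subspace_type
  subspace_type R[i] *%R (Num.conj \; *%R) subspace_inner
  subspace_inner_bilinear.

Let subspace_inner_herm (u v : subspace_type) :
  subspace_inner u v = (-1) ^+ false * (subspace_inner v u)^*.
Proof. exact: hermC. Qed.
HB.instance Definition _ := @isHermitianSesquilinear.Build R[i] subspace_type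
  false Num.conj subspace_inner subspace_inner_herm.

Let subspace_inner_gt0 (u : subspace_type) : u != 0 -> 0 < subspace_inner u u.
Proof. by move=> u0; apply: neq0_dnorm_gt0. Qed.
HB.instance Definition _ := @isDotProduct.Build R[i] subspace_type
  subspace_inner subspace_inner_gt0.

Let subspace_inner_norm (u : subspace_type) :
  (subspace_inner : {dot subspace_type for Num.conj}) u u = `|u| ^+ 2.
Proof. exact: inner_normE. Qed.
HB.instance Definition _ := @CompleteNormedModule_isHilbert.Build R
  subspace_type subspace_inner subspace_inner_norm.

Definition incl : subspace_type -> H := val.
HB.instance Definition _ := GRing.Linear.copy incl val.

Let incl_continuous : continuous incl.
Proof.
by apply: (bounded_hnormP incl).1; exists 1 => // u; rewrite mul1r.
Qed.
HB.instance Definition _ :=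
  isContinuous.Build subspace_type H incl incl_continuous.

End subspace_hilbert.

Section closure.
Variables (R : realType) (H : hilbertType R).
Implicit Types (A : set H) (x y : H) (a b e : R).

Lemma closure_hnorm A x : closure A x <->
  forall e, 0 < e -> exists2 y, A y & hnorm (x - y) < e.
Proof.
split=> [clA e e0|xA B].
  have /clA[y [Ay]] : nbhs x (ball x e%:C%C).
    by apply: nbhsx_ballx; rewrite ltr0c.
  by rewrite -ball_normE/= hnormE ltcR; exists y.
rewrite -nbhs_ballE => -[e /= e0]; have eE : e = (complex.Re e)%:C%C.
  by rewrite RRe_real// gtr0_real.
rewrite eE in e0 *; rewrite ltr0c in e0; move=> sB.
have [y Ay xy] := xA _ e0; exists y; split=> //; apply: sB.
by rewrite -ball_normE/= hnormE ltcR.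
Qed.

Lemma arbitrarily_small_le0 a b :
  0 <= b -> (forall e, 0 < e -> a <= e * b) -> a <= 0.
Proof.
move=> b0 ab; rewrite leNgt; apply/negP => a0.
have e0 : 0 < a / (2 * (b + 1)) by rewrite divr_gt0//; lra.
have := ab _ e0; have : a / (2 * (b + 1)) * (2 * (b + 1)) = a.
  by rewrite divfK//; lra.
lra.
Qed.

Lemma closed_Re_inner (w : H) : closed [set x | complex.Re (inner x w) = 0].
Proof.
move=> x /closure_hnorm xw; apply/eqP; rewrite -normr_le0.
apply: (@arbitrarily_small_le0 _ (hnorm w)) => [|e e0]; first exact: hnorm_ge0.
have [y /= yw xy] := xw e e0; rewrite -(subrK y x) linearDl ReD yw addr0.
apply: le_trans (CauchySchwarz_Re _ _) _.
by rewrite ler_wpM2r ?hnorm_ge0// ltW.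
Qed.

End closure.

Section subspaces.
Variables (R : realType) (H K : hilbertType R).

Definition orth_set (A : set H) : set H :=
  [set x | forall y, A y -> inner x y = 0].

Lemma orth_set_closed A : closed (orth_set A).
Proof.
have -> : orth_set A = \bigcap_(w in [set w | exists a y, A y /\ w = a *: y])
    [set x | complex.Re (inner x w) = 0].
  apply/seteqP; split=> x /=.
    by move=> xA _ [a [y [Ay ->]]]/=; rewrite innerZr xA// mulr0.
  move=> xA y Ay; apply/eqP; rewrite eq_complex/=; apply/andP; split.
    by apply/eqP; apply: xA; exists 1, y; rewrite scale1r.
  have := xA ('i%C *: y) (ex_intro _ 'i%C (ex_intro _ y (conj Ay erefl))).
  rewrite /= innerZr; case: (inner x y) => p q /=.
  by rewrite mulN1r mul0r opprK add0r => ->.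
by apply: closed_bigI => w _; exact: closed_Re_inner.
Qed.

Lemma orth_setP (A : set H) (a : R[i]) (x y : H) :
  orth_set A x -> orth_set A y -> orth_set A (a *: x + y).
Proof.
move=> xA yA w Aw.
by rewrite innerDl innerZl xA// yA// addr0 mulr0.
Qed.

Lemma orth_set0 (A : set H) : orth_set A 0.
Proof. by move=> w _; rewrite inner0l. Qed.

Definition orthocomp (A : set H) : closed_subspace H :=
  @ClosedSubspace R H (orth_set A)
    (@orth_set0 A) (@orth_setP A) (@orth_set_closed A).

Variable f : {bounded H -> K}.

Let ker0 : [set x | f x = 0] 0. Proof. exact: linear0. Qed.

Let kerP (a : R[i]) (x y : H) : [set x | f x = 0] x -> [set x | f x = 0] y ->
  [set x | f x = 0] (a *: x + y).
Proof. by move=> /= fx fy; rewrite linearP/= fx fy scaler0 addr0. Qed.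

Let ker_closed : closed [set x | f x = 0].
Proof.
have [M M0 fM] := (bounded_hnormP f).2 cts_fun.
move=> x /closure_hnorm xw; apply: hnorm0_eq0; apply/eqP.
rewrite eq_le hnorm_ge0 andbT.
apply: (@arbitrarily_small_le0 _ _ M) => // e e0.
have [y /= yw xy] := xw e e0; rewrite -(subrK y x) linearD/= yw addr0.
by apply: le_trans (fM _) _; rewrite mulrC ler_wpM2r// ltW.
Qed.

Definition nullspace : closed_subspace H :=
  @ClosedSubspace R H [set x | f x = 0] ker0 kerP ker_closed.

Let rg0 : closure (range f) 0.
Proof. by apply: subset_closure; exists 0 => //; rewrite linear0. Qed.

Let rgP (a : R[i]) (x y : K) : closure (range f) x -> closure (range f) y ->
  closure (range f) (a *: x + y).
Proof.
move=> /closure_hnorm fx /closure_hnorm fy; apply/closure_hnorm => e e0.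
pose n := complex.Re `|a|; have nE : `|a| = n%:C%C.
  by rewrite /n RRe_real// ger0_real.
have n0 : 0 <= n by rewrite -ler0c -nE.
have d0 : 0 < e / (2 * (n + 1)) by rewrite divr_gt0//; lra.
have [_ [u _ <-] xu] := fx _ d0; have [_ [v _ <-] yv] := fy _ d0.
exists (f (a *: u + v)); first by exists (a *: u + v).
rewrite linearP/= opprD addrACA -scalerBr.
apply: le_lt_trans (ler_hnormD _ _) _.
have -> : hnorm (a *: (x - f u)) = n * hnorm (x - f u).
  by rewrite {1}/hnorm normrZ nE ReM.
have dE : e / (2 * (n + 1)) * (2 * (n + 1)) = e by rewrite divfK//; lra.
move: (e / _) d0 xu yv dE => d d0 xu yv dE.
have : n * hnorm (x - f u) <= n * d by rewrite ler_wpM2l// ltW.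
nra.
Qed.

Definition closure_range : closed_subspace K :=
  @ClosedSubspace R K (closure (range f)) rg0 rgP (@closed_closure _ _).

End subspaces.

Section operators_between.
Variables (R : realType) (H K : hilbertType R).

Definition isometric (f : {bounded H -> K}) := forall x, `|f x| = `|x|.

Definition unitary (f : {bounded H -> K}) :=
  (forall x, adj f (f x) = x) /\ (forall y, f (adj f y) = y).

Definition opnorm (f : {bounded H -> K}) : R :=
  sup [set hnorm (f x) | x in [set x | hnorm x <= 1]].

End operators_between.

Section operators.
Variables (R : realType) (H : hilbertType R).
Implicit Types (A B P S T Y : {bounded H -> H}) (M : closed_subspace H).

(* [0 <= c] in [R[i]] says that [c] is real and nonnegative. *)
Definition positive_op A := forall x, 0 <= inner (A x) x.

Definition le_op A B := positive_op (B \- A).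

Definition Re_op Y : {bounded H -> H} := 2^-1 \*: (Y \+ adj Y).

Definition orth_projection P :=
  (forall x, P (P x) = P x) /\ (forall x, adj P x = P x).

Definition Delta T : {bounded H -> H} := (adj T \o T) \- idfun.

Definition two_isometry S :=
  forall x, adj S (adj S (S (S x))) - 2 *: adj S (S x) + x = 0.

Definition cov S : R := Num.sqrt (opnorm (Delta S)).

Definition contraction_wrt A T := le_op (adj T \o (A \o T)) A.

Definition isometry_wrt A T := forall x, adj T (A (T x)) = A x.

(* The diagonal entry at [M] of the matrix of [T] on [M + M^perp]; when [M] is
   invariant under [T], it is the restriction of [T] to [M]. *)
Definition compression T M : {bounded subspace_type M -> subspace_type M} :=
  adj (incl (M := M)) \o (T \o incl (M := M)).

Definition reducing T M := forall x,
  subspace_set M x -> subspace_set M (T x) /\ subspace_set M (adj T x).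

Definition closed_span (X : set H) : set H :=
  \bigcap_(M in [set M : closed_subspace H | X `<=` M]) (M : set H).

End operators.

(* A shift. *)
Definition pure_isometry (R : realType) (H : hilbertType R)
    (T : {bounded H -> H}) :=
  isometric T /\
  forall M : closed_subspace H, reducing T M -> unitary (compression T M) ->
    forall x, subspace_set M x -> x = 0.

(* The main diagonal of the matrix of [W] on [N(Delta W) + closure R(Delta W)]. *)
Section canonical_representation.
Variables (R : realType) (L : hilbertType R) (W : {bounded L -> L}).

Definition canonical_ul := compression W (nullspace (Delta W)).
Definition canonical_dr := compression W (closure_range (Delta W)).

End canonical_representation.

(* An inclusion of Hilbert spaces [H] in [K] is given by an isometric map
   [J : H -> K], [H] being identified with [range J]. Then [adj J : K -> H] is
   the orthogonal projection of [K] onto [H]. *)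
Section lifting.
Variables (R : realType) (H K : hilbertType R).
Variables (J : {bounded H -> K}) (S : {bounded K -> K}) (T : {bounded H -> H}).

Definition lifting := isometric J /\ forall k, adj J (S k) = T (adj J k).

Definition perp : closed_subspace K := orthocomp (range J).

(* The entries [W] and [X] of the matrix of [S] on [H^perp + H]. *)
Definition perp_part : {bounded subspace_type perp -> subspace_type perp} :=
  compression S perp.
Definition perp_entry : {bounded H -> subspace_type perp} :=
  adj (incl (M := perp)) \o (S \o J).

Definition leaves_invariant (B : {bounded K -> K}) :=
  forall h, range J (B (J h)).

Definition two_isometric_lifting := two_isometry S /\ lifting.

Definition type_II := leaves_invariant (adj S \o S).

Definition minimal :=
  closed_span (\bigcup_n [set iter n S (J h) | h in [set: H]]) = [set: K].

Definition entries_condition :=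
  let W := perp_part in let X := perp_entry in
  positive_op ((adj X \o (Delta W \o X)) \+
               2 \*: Re_op (adj X \o (adj W \o (X \o T)))).

End lifting.

(* Main.v *)
Require Import Defs.
From mathcomp Require Import all_boot all_order all_algebra.
From mathcomp Require Import all_classical all_reals all_analysis.
From mathcomp Require Import complex.
From HB Require Import structures.
From mathcomp Require Import ring lra.

Set Implicit Arguments.
Unset Strict Implicit.
Unset Printing Implicit Defensive.

Import Order.TTheory GRing.Theory Num.Theory.
Import numFieldNormedType.Exports.
Local Open Scope classical_set_scope.
Local Open Scope ring_scope.

Local Notation incl := Defs.incl.

(** All the conditions are compared with (ii).

    From a lifting to (ii). Let [S] be a lifting of [T] to a space that contains
    [H], and let [B >= 0] dominate [Delta S]. Write [S h = T h + u] with [u]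
    orthogonal to [H]. The compression [A] of [B] to [H] dominates [Delta T],
    because passing from [S h] to [T h] only loses [|u|^2]
    ([compression_dominates]). If moreover [S^* B S = B] and [B] leaves [H]
    invariant, then [<B u, T h> = 0] and
    [<A h, h> = <A (T h), T h> + <B u, u>], so [T] is an [A]-contraction
    ([compression_contraction]). This covers (iii), and also (i) with
    [B = Delta S], which is positive because the squared norms along an orbit of
    a 2-isometry are in arithmetic progression. In (iv), the form that is assumed nonnegative is
    [<A h, h> - <A (T h), T h>] for the compression [A] of [Delta S]: the
    condition on the entries holds if and only if [T] is a contraction with
    respect to this [A] ([entries_conditionP]), and so every lifting of type II
    satisfies it. If [A] happens to be zero, then [T] is a contraction and the
    identity replaces [A] ([dominated_neq0]).

    From (ii) to a lifting. By (ii) the operators [A - T^* A T] and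
    [(A - Delta T) + T^* A T] are positive. A positive operator [C] is [X^* X]
    for some [X] from [H] to the space [G] of square-summable sequences of [H]:
    if [0 <= C <= 1], put [C_0 = C] and [C_(n+1) = C_n - C_n^2]; the squares
    telescope to [C], so [X x = (C_0 x, C_1 x, ...)] works
    ([positive_factor]). Let [X1] and [X0] be the factors of the two operators
    above, let [L] be the space of square-summable sequences of [G], and put
      [S (f0, f1, f2, f3, ...) =
         (T f0, X1 f0 & f1, X0 f0 & sqrt 2 f1, f2, f3, ...)]
    on [H + L + L + ...], where [x & l] is the sequence [l] preceded by [x].
    Adding up the norms, [Delta S] is the diagonal operator with entries
    [2 A, 2, 0, 0, ...]. It maps [H] to itself and its norm is
    [2 max (1, |A|)]. It is preserved by [S], since [X1] stores what the form of
    [A] loses from [h] to [T h]; thus [S] is a 2-isometry. On the complement of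
    [H], [Delta W] is twice the projection onto the coordinate 1, [W] shifts the
    coordinates on the kernel of [Delta W], and its compression to the range is
    the shift of [L]. Such operators are pure since no nonzero vector lies in
    the ranges of all their powers ([pure_isometry_iter]).

    A minimal lifting is the restriction of any lifting of type II to the closed
    span of the orbits of [H] ([minimal_lifting]). *)

(** * Square-summable sequences of vectors *)

Section summation.
Variable R : realType.
Implicit Types (u v : nat -> R[i]) (a : R[i]).

(** Complex series are summed through their real and imaginary parts, so that
    the convergence theorems for real series apply to each of them. *)
Definition csummable u :=
  cvgn (series (fun n => complex.Re (u n))) /\
  cvgn (series (fun n => complex.Im (u n))).

Definition csum u : R[i] :=
  (limn (series (fun n => complex.Re (u n))) +i*
   limn (series (fun n => complex.Im (u n))))%C.

Lemma csum_unique u (p q : R) :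
  series (fun n => complex.Re (u n)) @ \oo --> p ->
  series (fun n => complex.Im (u n)) @ \oo --> q -> csum u = (p +i* q)%C.
Proof.
by move=> up uq; rewrite /csum; congr Complex; apply/cvg_lim.
Qed.

Lemma cvg_series_lin (p q x y z : R) (f g h : nat -> R) :
  series f @ \oo --> x -> series g @ \oo --> y -> series h @ \oo --> z ->
  series (fun n => p * f n + q * g n + h n) @ \oo --> p * x + q * y + z.
Proof.
move=> fx gy hz; rewrite (_ : series _ =
    fun n => p * series f n + q * series g n + series h n).
  by apply: cvgD => //; apply: cvgD; exact: cvgMl_tmp.
by apply/funext => n; rewrite /series/= !big_split/= !mulr_sumr.
Qed.

Lemma csumP a u v : csummable u -> csummable v ->
  csum (fun n => a * u n + v n) = a * csum u + csum v.
Proof.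
move=> [ur ui] [vr vi]; case: a => p q.
rewrite (@csum_unique _
  (p * complex.Re (csum u) - q * complex.Im (csum u) + complex.Re (csum v))
  (p * complex.Im (csum u) + q * complex.Re (csum u) + complex.Im (csum v))).
- by rewrite /csum/=.
- rewrite -mulNr (_ : (fun n => _) = fun n =>
      p * complex.Re (u n) + - q * complex.Im (u n) + complex.Re (v n)).
    exact: cvg_series_lin.
  by apply/funext => n; case: (u n) => ? ?; case: (v n) => ? ? /=; ring.
- rewrite (_ : (fun n => _) = fun n =>
      p * complex.Im (u n) + q * complex.Re (u n) + complex.Im (v n)).
    exact: cvg_series_lin.
  by apply/funext => n; case: (u n) => ? ?; case: (v n) => ? ? /=; ring.
Qed.

Lemma csumJ u : csummable u -> csum (fun n => (u n)^*) = (csum u)^*.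
Proof.
move=> [ur ui]; rewrite (@csum_unique _ (complex.Re (csum u))
  (- complex.Im (csum u)))//.
- by rewrite (_ : (fun n => _) = fun n => complex.Re (u n))//;
    apply/funext => n; case: (u n).
- rewrite (_ : series _ = - series (fun n => complex.Im (u n))).
    exact: cvgN.
  apply/funext => n; rewrite /series/= fctE -sumrN; apply: eq_bigr => k _.
  by case: (u k).
Qed.

(** Splitting off the first term is what turns [l2 F] into the orthogonal sum
    of [F 0] and of the [l2] space of the remaining summands. *)
Lemma csumS u : csummable u -> csum u = u 0 + csum (fun n => u n.+1).
Proof.
have shift (f : nat -> R) x : series f @ \oo --> x ->
    series (fun n => f n.+1) @ \oo --> x - f 0.
  rewrite -cvg_shiftS => fx; rewrite (_ : series _ =
      fun n => series f n.+1 - f 0); first by apply: cvgB => //; exact: cvg_cst.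
  by apply/funext => n; rewrite /series/= big_nat_recl// addrC addKr.
move=> [ur ui].
rewrite (csum_unique (shift _ _ ur) (shift _ _ ui)).
by rewrite /csum; case: (u 0) => p q; rewrite /GRing.add/= !subrKC.
Qed.

Lemma csummable_le u (w : nat -> R) :
  (forall n, `|complex.Re (u n)| <= w n) ->
  (forall n, `|complex.Im (u n)| <= w n) ->
  cvgn (series w) -> csummable u.
Proof.
move=> uw vw cw; have w0 n : 0 <= w n by apply: le_trans (uw n).
split; apply: normed_cvg; apply: (series_le_cvg _ w0 _ cw) => n //=.
Qed.

End summation.

Section norm_estimates.
Variables (R : realType) (H : hilbertType R).

Lemma hnorm_scale (a : R[i]) (x : H) :
  hnorm (a *: x) = complex.Re `|a| * hnorm x.
Proof.
have a0 : 0 <= complex.Re `|a| by rewrite -ler0c RRe_real// ger0_real.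
rewrite -(ger0_norm a0) -hnormZ /hnorm !normrZ.
by rewrite RRe_real ?ger0_real// normr_id.
Qed.

Lemma ler_hnormD2 (x y : H) :
  hnorm (x + y) ^+ 2 <= 2 * hnorm x ^+ 2 + 2 * hnorm y ^+ 2.
Proof.
rewrite hnormD2; have := sqr_ge0 (hnorm x - hnorm y).
have := le_trans (ler_norm _) (CauchySchwarz_Re x y); nra.
Qed.

End norm_estimates.

Section l2.
Variables (R : realType) (F : nat -> hilbertType R).

Definition square_summable (f : forall n, F n) :=
  exists M, forall n, \sum_(0 <= k < n) hnorm (f k) ^+ 2 <= M.

(** The Hilbert sum of the [F n]. The summands are allowed to differ because the
    space of the lifting is the sum of [H] and of copies of another space. *)
Record l2 := L2 { coord :> forall n, F n ; coord_l2 : square_summable coord }.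

Lemma l2P (f g : l2) : (forall n, f n = g n) -> f = g.
Proof.
case: f g => f fM [g gM] /= fg.
have {}fg : f = g by apply: functional_extensionality_dep.
by case: _ / fg in gM *; congr L2; exact: Prop_irrelevance.
Qed.

HB.instance Definition _ := gen_eqMixin l2.
HB.instance Definition _ := gen_choiceMixin l2.

Lemma square_summable0 : square_summable (fun n => 0).
Proof.
exists 0 => n; rewrite big1// => k _.
by rewrite /hnorm normr0/= expr0n.
Qed.

Lemma square_summable_lin (a : R[i]) (f g : forall n, F n) :
  square_summable f -> square_summable g ->
  square_summable (fun n => a *: f n + g n).
Proof.
move=> [M fM] [N gN]; exists (2 * (complex.Re `|a| ^+ 2 * M) + 2 * N) => n.
apply: (@le_trans _ _ (\sum_(0 <= k < n) (2 * (complex.Re `|a| ^+ 2 *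
    hnorm (f k) ^+ 2) + 2 * hnorm (g k) ^+ 2))).
  apply: ler_sum => k _; apply: le_trans (ler_hnormD2 _ _) _.
  by rewrite hnorm_scale exprMn.
rewrite big_split/= -!mulr_sumr lerD// ler_pM2l// ler_wpM2l//.
exact: sqr_ge0.
Qed.

Definition l2_zero := L2 square_summable0.

(** The affine operation [a f + g] alone gives the sum, the opposite and the
    scaling, with a single proof of square-summability. *)
Definition l2_lin a (f g : l2) : l2 :=
  L2 (square_summable_lin a (coord_l2 f) (coord_l2 g)).

Let addf (f g : l2) : l2 := l2_lin 1 f g.
Let oppf (f : l2) : l2 := l2_lin (-1) f l2_zero.
Let scalef a (f : l2) : l2 := l2_lin a f l2_zero.

Let addfA : associative addf.
Proof. by move=> f g h; apply: l2P => n /=; rewrite !scale1r addrA. Qed.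
Let addfC : commutative addf.
Proof. by move=> f g; apply: l2P => n /=; rewrite !scale1r addrC. Qed.
Let add0f : left_id l2_zero addf.
Proof. by move=> f; apply: l2P => n /=; rewrite scaler0 add0r. Qed.
Let addNf : left_inverse l2_zero oppf addf.
Proof.
by move=> f; apply: l2P => n /=; rewrite scale1r addr0 scaleN1r addNr.
Qed.
HB.instance Definition _ := GRing.isZmodule.Build l2 addfA addfC add0f addNf.

Let scalefA a b f : scalef a (scalef b f) = scalef (a * b) f.
Proof. by apply: l2P => n /=; rewrite !addr0 scalerA. Qed.
Let scale1f : left_id 1 scalef.
Proof. by move=> f; apply: l2P => n /=; rewrite addr0 scale1r. Qed.
Let scalefDr : right_distributive scalef +%R.
Proof.
by move=> a f g; apply: l2P => n /=; rewrite !addr0 !scale1r scalerDr.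
Qed.
Let scalefDl f : {morph scalef^~ f : a b / a + b}.
Proof. by move=> a b; apply: l2P => n /=; rewrite !addr0 scale1r scalerDl. Qed.
HB.instance Definition _ :=
  GRing.Zmodule_isLmodule.Build R[i] l2 scalefA scale1f scalefDr scalefDl.

Lemma coordP n a (f g : l2) : (a *: f + g) n = a *: f n + g n.
Proof. by rewrite /= scale1r addr0. Qed.

Lemma coordB n (f g : l2) : (f - g) n = f n - g n.
Proof. by rewrite addrC -scaleN1r coordP scaleN1r addrC. Qed.

Lemma sum_hnorm_nd (f : l2) :
  nondecreasing_seq (series (fun n => hnorm (f n) ^+ 2)).
Proof. by apply: nondecreasing_series => n _ _; exact: sqr_ge0. Qed.

Lemma cvg_sum_hnorm (f : l2) : cvgn (series (fun n => hnorm (f n) ^+ 2)).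
Proof.
apply: nondecreasing_is_cvgn; first exact: sum_hnorm_nd.
by have [M fM] := coord_l2 f; exists M => _ [n _ <-]; exact: fM.
Qed.

Lemma csummable_inner (f g : l2) : csummable (fun n => inner (f n) (g n)).
Proof.
have bnd (H : hilbertType R) (x y : H) :
    `|complex.Re (inner x y)| <= hnorm x ^+ 2 + hnorm y ^+ 2.
  apply: le_trans (CauchySchwarz_Re x y) _.
  have := sqr_ge0 (hnorm x - hnorm y); have := hnorm_ge0 x.
  have := hnorm_ge0 y; nra.
apply: (@csummable_le _ _ (fun n => hnorm (f n) ^+ 2 + hnorm (g n) ^+ 2)).
- by move=> n; exact: bnd.
- move=> n; have := bnd _ ('i%C *: f n) (g n); rewrite innerZl mulrC ReiNIm normrN.
  rewrite hnorm_scale (_ : complex.Re `|'i%C| = 1) ?mul1r//.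
  by rewrite normc_def/= expr0n/= expr1n add0r sqrtr1.
- rewrite (_ : series _ = series (fun n => hnorm (f n) ^+ 2) +
      series (fun n => hnorm (g n) ^+ 2)).
    by apply: is_cvgD; exact: cvg_sum_hnorm.
  by apply/funext => n; rewrite /series/= big_split.
Qed.

Definition l2_inner (f g : l2) : R[i] := csum (fun n => inner (f n) (g n)).

Let inner_lin g a f h :
  l2_inner (a *: f + h) g = a * l2_inner f g + l2_inner h g.
Proof.
rewrite /l2_inner -csumP; try exact: csummable_inner.
by congr csum; apply/funext => n; rewrite coordP innerDl innerZl.
Qed.

Let inner_conj f g : l2_inner f g = (l2_inner g f)^*.
Proof.
rewrite /l2_inner -csumJ; last exact: csummable_inner.
by congr csum; apply/funext => n; rewrite innerC.
Qed.

Let inner_bilinear : bilinear_for *%R (Num.conj \; *%R) l2_inner.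
Proof.
split=> [g a f h|f a g h]; first exact: inner_lin.
rewrite [LHS]inner_conj inner_lin rmorphD rmorphM.
by rewrite /= -!inner_conj.
Qed.
HB.instance Definition _ := @bilinear_isBilinear.Build R[i] l2 l2 R[i] *%R
  (Num.conj \; *%R) l2_inner inner_bilinear.

Let inner_herm (f g : l2) : l2_inner f g = (-1) ^+ false * (l2_inner g f)^*.
Proof. by rewrite expr0 mul1r inner_conj. Qed.
HB.instance Definition _ := @isHermitianSesquilinear.Build R[i] l2
  false Num.conj l2_inner inner_herm.

Definition l2_sqnorm (f : l2) : R := limn (series (fun n => hnorm (f n) ^+ 2)).

Lemma l2_innerxx f : l2_inner f f = (l2_sqnorm f)%:C%C.
Proof.
rewrite /l2_inner (@csum_unique _ _ (l2_sqnorm f) 0)//.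
- rewrite (_ : (fun n => _) = fun n => hnorm (f n) ^+ 2).
    exact: cvg_sum_hnorm.
  by apply/funext => n; rewrite Re_innerxx.
- rewrite (_ : series _ = fun=> 0); first exact: cvg_cst.
  apply/funext => n; rewrite /series/= big1// => k _.
  by rewrite inner_normE hnormE -rmorphXn.
Qed.

Lemma l2_sqnorm_le (f : l2) n :
  \sum_(0 <= k < n) hnorm (f k) ^+ 2 <= l2_sqnorm f.
Proof.
exact: (nondecreasing_cvgn_le (sum_hnorm_nd f) (@cvg_sum_hnorm f) n).
Qed.

Lemma l2_sqnorm_ub (f : l2) M :
  (forall n, \sum_(0 <= k < n) hnorm (f k) ^+ 2 <= M) -> l2_sqnorm f <= M.
Proof.
by move=> fM; apply: limr_le; [exact: cvg_sum_hnorm|exact: nearW].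
Qed.

Lemma hnorm_coord_sqnorm (f : l2) n : hnorm (f n) ^+ 2 <= l2_sqnorm f.
Proof.
apply: le_trans (l2_sqnorm_le f n.+1); rewrite big_nat_recr//= lerDr.
by apply: sumr_ge0 => k _; exact: sqr_ge0.
Qed.

Let sqnorm_ge0 f : 0 <= l2_sqnorm f.
Proof. by apply: le_trans (hnorm_coord_sqnorm f 0); exact: sqr_ge0. Qed.

Let sqnorm_eq0 f : l2_sqnorm f = 0 -> f = 0.
Proof.
move=> f0; apply: l2P => n; apply: hnorm0_eq0; apply/eqP.
by rewrite -sqrf_eq0 eq_le sqr_ge0 andbT -f0 hnorm_coord_sqnorm.
Qed.

Let inner_gt0 (f : l2) : f != 0 -> 0 < l2_inner f f.
Proof.
move=> f0; rewrite l2_innerxx ltr0c lt_def sqnorm_ge0 andbT.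
by apply: contra_neq f0; exact: sqnorm_eq0.
Qed.
HB.instance Definition _ :=
  @isDotProduct.Build R[i] l2 l2_inner inner_gt0.

Let norm (f : l2) : R[i] := (Num.sqrt (l2_sqnorm f))%:C%C.

(* The left-hand side is nonnegative for all [t]: this is the quadratic
   polynomial behind the Cauchy-Schwarz inequality. *)
Let sqnormD (f g : l2) t : l2_sqnorm (f + t%:C%C *: g) =
  l2_sqnorm f + 2 * t * complex.Re (l2_inner f g) + t ^+ 2 * l2_sqnorm g.
Proof.
have E : l2_inner (f + t%:C%C *: g) (f + t%:C%C *: g) = l2_inner f f +
  t%:C%C * l2_inner f g + t%:C%C * (l2_inner f g)^* +
  t%:C%C * (t%:C%C * l2_inner g g).
  rewrite !(linearDl, linearDr, linearZl_LR, linearZr_LR)/= -inner_conj.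
  have -> : Num.conj t%:C%C = t%:C%C :> R[i].
    by apply/CrealP; rewrite complex_real.
  ring.
move: E; rewrite !l2_innerxx; case: (l2_inner f g) => p q.
by move=> /(congr1 (@complex.Re R))/= ->; ring.
Qed.

Let normD f g : norm (f + g) <= norm f + norm g.
Proof.
rewrite /norm -rmorphD lecR -ler_sqr ?nnegrE ?addr_ge0 ?sqrtr_ge0//.
rewrite sqrrD !sqr_sqrtr// -sqrtrM//.
have := sqnormD f g 1; rewrite (_ : 1%:C%C = 1 :> R[i])// scale1r => ->.
have CS : complex.Re (l2_inner f g) ^+ 2 <= l2_sqnorm f * l2_sqnorm g.
  by apply: discriminant_le => // t; rewrite -sqnormD.
have := ler_norm (complex.Re (l2_inner f g)); move: CS.
rewrite -ler_sqrt ?mulr_ge0// sqrtr_sqr; lra.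
Qed.

Let normZ a f : norm (a *: f) = `|a| * norm f.
Proof.
have aE : `|a| = (complex.Re `|a|)%:C%C by rewrite RRe_real// ger0_real.
have a0 : 0 <= complex.Re `|a| by rewrite -ler0c -aE.
rewrite aE /norm -rmorphM; congr (_%:C%C).
rewrite -(ger0_norm a0) -sqrtr_sqr -sqrtrM ?sqr_ge0//; congr Num.sqrt.
apply: complexI; rewrite -l2_innerxx linearZl_LR linearZr_LR/= mulrA -normCK.
by rewrite [X in _ * X]l2_innerxx rmorphM rmorphXn/= -aE.
Qed.

Let norm0 f : norm f = 0 -> f = 0.
Proof.
move=> /complexI/eqP; rewrite sqrtr_eq0 => f0; apply: sqnorm_eq0.
by apply/eqP; rewrite eq_le f0 sqnorm_ge0.
Qed.
HB.instance Definition _ := Lmodule_isNormed.Build R[i] l2 normD normZ norm0.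


Let rnorm (f : l2) : R := Num.sqrt (l2_sqnorm f).

Let rnormE (f : l2) : rnorm f ^+ 2 = l2_sqnorm f.
Proof. by rewrite sqr_sqrtr. Qed.

Let rnorm_coord (f : l2) n : hnorm (f n) <= rnorm f.
Proof.
by rewrite -ler_sqr ?nnegrE ?hnorm_ge0 ?sqrtr_ge0// rnormE hnorm_coord_sqnorm.
Qed.

(** The coordinates of a Cauchy filter converge, to [x] say. If [f] is [e]-close
    to all the elements of a set [P] of the filter, then each finite partial sum
    of the squared distances between [f] and [x] is controlled by choosing in
    [P] an element whose first coordinates are near those of [x]. The bound
    does not depend on the length of the partial sum, so it shows both that [x]
    is square-summable and that the filter converges to it. *)
Let complete (G : set_system l2) : ProperFilter G -> cauchy G -> cvg G.
Proof.
move=> GG /cauchy_ballP Gc.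
have near_le e : 0 < e -> exists2 P, G P &
    forall f g, P f -> P g -> rnorm (f - g) <= e.
  move=> e0; have [|[P Q] /= [GP GQ] PQ] := Gc (e%:C%C).
    by rewrite ltr0c.
  exists (P `&` Q); first exact: filterI.
  move=> f g [Pf _] [_ Qg]; have := PQ (f, g) (conj Pf Qg).
  by rewrite /= -ball_normE/= ltcR => /ltW.
have coordG n : cauchy ((fun f : l2 => f n) @ G).
  apply: cauchy_exP => e e0; have eE : e = (complex.Re e)%:C%C.
    by rewrite RRe_real// gtr0_real.
  rewrite eE in e0 *; rewrite ltr0c in e0.
  have [P GP Pe] := near_le (complex.Re e / 2) (divr_gt0 e0 (ltr0Sn R 1)).
  have [f Pf] := filter_ex GP; exists (f n).
  have : G (fun g => ball (f n) (complex.Re e)%:C%C (g n)); last by [].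
  apply: filterS GP => g Pg; rewrite -ball_normE/= hnormE ltcR -coordB.
  apply: le_lt_trans (rnorm_coord _ _) _.
  by apply: le_lt_trans (Pe _ _ Pf Pg) _; lra.
pose x n : F n := lim ((fun f : l2 => f n) @ G).
have xG n e : 0 < e -> G [set f | hnorm (f n - x n) < e].
  move=> e0; have Gx : (fun f : l2 => f n) @ G --> x n.
    by apply: cauchy_cvg; exact: coordG.
  have : G (fun f => ball (x n) e%:C%C (f n)).
    by apply: (fcvg_ball Gx); rewrite ltr0c.
  apply: filterS => f; rewrite -ball_normE/= hnormE ltcR.
  by rewrite /hnorm -normrN opprB.
have sum_le (P : set l2) e n f : 0 < e -> G P ->
    (forall g, P g -> rnorm (f - g) <= e) ->
    \sum_(0 <= k < n) hnorm (f k - x k) ^+ 2 <= 4 * e ^+ 2.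
  move=> e0 GP fP.
  (* The [n] errors on the coordinates add up to less than [2 * e ^+ 2]. *)
  have d0 : 0 < e / (n%:R + 1) by rewrite divr_gt0// ltr_wpDl.
  have : G [set g | forall k, (k < n)%N -> hnorm (g k - x k) < e / (n%:R + 1)].
    move: {1}n => m; elim: m => [|m IH]; first exact: filterE.
    apply: filterS2 IH (xG m _ d0) => g gm mx k; rewrite ltnS leq_eqVlt.
    by move=> /predU1P[->//|]; exact: gm.
  move=> /(filterI GP)/filter_ex[g [Pg gx]].
  apply: (@le_trans _ _ (\sum_(0 <= k < n)
      (2 * hnorm ((f - g) k) ^+ 2 + 2 * (e / (n%:R + 1)) ^+ 2))).
    apply: ler_sum_nat => k /andP[_ kn].
    rewrite -(subrKA (g k)) -coordB.
    apply: le_trans (ler_hnormD2 _ _) _; rewrite lerD2l ler_pM2l//.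
    by rewrite ler_sqr ?nnegrE ?hnorm_ge0 ?(ltW d0)// ltW// gx.
  rewrite big_split/= -mulr_sumr sumr_const_nat subn0.
  have := l2_sqnorm_le (f - g) n; rewrite -rnormE.
  have : rnorm (f - g) ^+ 2 <= e ^+ 2.
    by rewrite ler_sqr ?nnegrE ?sqrtr_ge0 ?(ltW e0)// fP.
  have : (2 * (e / (n%:R + 1)) ^+ 2) *+ n <= 2 * e ^+ 2.
    have n0 := ler0n R n.
    have : e / (n%:R + 1) * (n%:R + 1) = e by rewrite divfK//; lra.
    move: (e / _) => q <-; rewrite -mulr_natr exprMn -mulrA ler_pM2l//.
    by rewrite ler_wpM2l ?sqr_ge0//; nra.
  lra.
have xl2 : square_summable x.
  have [P GP P1] := near_le 1 ltr01.
  have [f Pf] := filter_ex GP.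
  have [M fM] := coord_l2 f; exists (2 * M + 2 * (4 * 1 ^+ 2)) => n.
  have := sum_le P 1 n f ltr01 GP (fun g => P1 f g Pf); have := fM n.
  rewrite -(ler_pM2l (ltr0Sn R 1)) -(ler_pM2l (ltr0Sn R 1) (\sum_(_ <= _ < _) _)).
  move=> /lerD /[apply]; apply: le_trans; rewrite !mulr_sumr -big_split/=.
  apply: ler_sum => k _; rewrite -{1}(subKr (f k) (x k)).
  apply: le_trans (ler_hnormD2 _ _) _.
  by rewrite [hnorm (- _)]/hnorm normrN.
apply/cvg_ex; exists (L2 xl2); apply/fcvg_ballP => e e0.
have eE : e = (complex.Re e)%:C%C by rewrite RRe_real// gtr0_real.
rewrite eE in e0 *; rewrite ltr0c in e0.
have d0 : 0 < complex.Re e / 3 by rewrite divr_gt0.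
have [P GP Pe] := near_le _ d0.
apply: filterS (GP) => f Pf; rewrite -ball_normE/= distrC ltcR.
have /l2_sqnorm_ub : forall n, \sum_(0 <= k < n)
    hnorm ((f - L2 xl2) k) ^+ 2 <= 4 * (complex.Re e / 3) ^+ 2.
  move=> n; under eq_bigr do rewrite coordB.
  by apply: (sum_le P) => // g Pg; exact: Pe.
move=> h; rewrite -rnormE in h.
rewrite -ltr_sqr ?nnegrE ?sqrtr_ge0 ?(ltW e0)//; apply: le_lt_trans h _.
by have := exprn_gt0 2 e0; nra.
Qed.
HB.instance Definition _ := Uniform_isComplete.Build l2 complete.

Let inner_norm (f : l2) :
  (l2_inner : {dot l2 for Num.conj}) f f = `|f| ^+ 2.
Proof. by rewrite -rmorphXn/= rnormE -l2_innerxx. Qed.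
HB.instance Definition _ := @CompleteNormedModule_isHilbert.Build R
  l2 l2_inner inner_norm.

Lemma l2_hnormE (f : l2) : hnorm f ^+ 2 = l2_sqnorm f.
Proof. by rewrite /hnorm/= sqr_sqrtr. Qed.

End l2.

(** * Quadratic forms and 2-isometries *)

Section forms.
Variables (R : realType) (H : hilbertType R).
Implicit Types (A C D : {bounded H -> H}).

(** Complex polarization: the vectors [x + y] and [x + i y] together give
    [inner (D x) y = 0]. Equalities between operators are obtained below from
    equalities between quadratic forms. *)
Lemma form0 D : (forall x, inner (D x) x = 0) -> forall x, D x = 0.
Proof.
move=> D0 x; apply: inner_ext => y; rewrite inner0r.
rewrite innerC; suff -> : inner (D x) y = 0 by rewrite rmorph0.
have := D0 (x + y); have := D0 (x + 'i%C *: y).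
rewrite !linearD !linearZ/= !(linearDl, linearDr, linearZl_LR, linearZr_LR)/=.
rewrite !D0; case: (inner (D x) y) => a b; case: (inner (D y) x) => c d.
move=> /eqP; rewrite eq_complex/= => /andP[/eqP h1 /eqP h2].
move=> /eqP; rewrite eq_complex/= => /andP[/eqP h3 /eqP h4].
by apply/eqP; rewrite eq_complex/=; apply/andP; split; apply/eqP; lra.
Qed.

(** A positive operator has real quadratic form, which is therefore also that of
    its adjoint. *)
Lemma positive_selfadjoint A : positive_op A ->
  forall x y, inner (A x) y = inner x (A y).
Proof.
move=> A0 x y; rewrite adjP; congr (inner x _); apply/eqP.
rewrite eq_sym -subr_eq0; apply/eqP; apply: (form0 (D := A \- adj A)) => {}x.
rewrite [LHS]innerBl [inner (adj A x) x]innerC -adjP.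
by rewrite [_^*]conj_Creal ?subrr// ger0_real.
Qed.

End forms.

Section bounded_op.
Variables (R : realType) (H K : hilbertType R) (f : H -> K) (M : R).
Hypothesis fL : linear f.
Hypothesis fM : forall x, hnorm (f x) ^+ 2 <= M * hnorm x ^+ 2.

Let fL' := GRing.isLinear.Build _ _ _ _ f fL.
Let f_linear : {linear H -> K} := HB.pack f fL'.

Let f_continuous : continuous f.
Proof.
apply: (bounded_hnormP f_linear).1; exists (Num.sqrt (Num.max M 0)) => [|x].
  exact: sqrtr_ge0.
rewrite -ler_sqr ?nnegrE ?mulr_ge0 ?hnorm_ge0 ?sqrtr_ge0//.
rewrite exprMn sqr_sqrtr ?le_max ?lexx ?orbT//; apply: le_trans (fM x) _.
by rewrite ler_wpM2r ?sqr_ge0// le_max lexx.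
Qed.

Let f_continuous' := isContinuous.Build H K f f_continuous.

Definition bounded_op : {bounded H -> K} := HB.pack f fL' f_continuous'.

End bounded_op.

Section two_isometries.
Variables (R : realType).

Lemma inner_ge0 (H : hilbertType R) (x : H) : 0 <= inner x x.
Proof. exact: dnorm_ge0. Qed.

Lemma DeltaE (H : hilbertType R) (S : {bounded H -> H}) x y :
  inner (Delta S x) y = inner (S x) (S y) - inner x y.
Proof. by rewrite [LHS]innerBl/= [inner (adj _ _) _]innerC -adjP -innerC. Qed.

Lemma isometric_inner (H K : hilbertType R) (J : {bounded H -> K}) :
  isometric J -> forall x y, inner (J x) (J y) = inner x y.
Proof.
move=> Ji x y; have D0 : forall z, ((adj J \o J) \- idfun) z = 0.
  apply: (form0 (D := (adj J \o J) \- idfun)) => z.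
  by rewrite [LHS]innerBl/= innerC -adjP !inner_normE Ji conj_Creal ?subrr
    ?realX ?normr_real.
by rewrite adjP; congr (inner x _); apply/eqP; rewrite -subr_eq0 [_ - _]D0.
Qed.

Lemma isometric_adjK (H K : hilbertType R) (J : {bounded H -> K}) :
  isometric J -> cancel J (adj J).
Proof.
by move=> Ji x; apply: inner_ext => y; rewrite -adjP isometric_inner.
Qed.

Lemma two_isometryP (H : hilbertType R) (S : {bounded H -> H}) :
  two_isometry S <-> forall x y,
    inner (Delta S (S x)) (S y) = inner (Delta S x) y.
Proof.
have E x y : inner (adj S (adj S (S (S x))) - 2 *: adj S (S x) + x) y =
    inner (Delta S (S x)) (S y) - inner (Delta S x) y.
  rewrite !DeltaE innerDl innerBl innerZl !(innerC _ y) -!adjP -!innerC.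
  by ring.
split=> [S2 x y|S2 x].
  by apply/eqP; rewrite -subr_eq0 -E S2 inner0l.
apply/eqP; rewrite -(@dnorm_eq0 _ _ inner).
by rewrite [X in X == 0]E S2 subrr.
Qed.

Lemma two_isometry_Delta (H : hilbertType R) (S : {bounded H -> H}) :
  two_isometry S -> isometry_wrt (Delta S) S.
Proof.
move=> /two_isometryP S2 x; apply: inner_ext => y.
by rewrite -adjP innerC [RHS]innerC S2.
Qed.

(** Along an orbit of a 2-isometry the squared norm is an affine function of [n],
    namely [|x|^2 + n <Delta x, x>]. It stays nonnegative, so its slope does. *)
Lemma two_isometry_Delta_ge0 (H : hilbertType R) (S : {bounded H -> H}) :
  two_isometry S -> positive_op (Delta S).
Proof.
move=> /two_isometryP S2 x; set d := inner _ _.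
have dE : d = (complex.Re d)%:C%C.
  rewrite RRe_real// /d DeltaE !inner_normE.
  by rewrite rpredB// realX ?normr_real.
rewrite dE ler0c leNgt; apply/negP => d0.
have iterE n : inner (iter n S x) (iter n S x) = inner x x + n%:R * d /\
    inner (Delta S (iter n S x)) (iter n S x) = d.
  elim: n => [|n [IH1 IH2]]; first by rewrite mul0r addr0.
  split; last by rewrite S2.
  have := DeltaE S (iter n S x) (iter n S x).
  rewrite IH2 IH1 => /eqP; rewrite eq_sym subr_eq => /eqP -> /=.
  by rewrite -natr1; ring.
have bnd n : 0 <= hnorm x ^+ 2 + n%:R * complex.Re d.
  have := sqr_ge0 (hnorm (iter n S x)).
  rewrite -!Re_innerxx (iterE n).1 ReD {1}dE.
  by rewrite -(rmorph_nat (@real_complex R)) -rmorphM.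
have [n nE] : exists n : nat, hnorm x ^+ 2 < n%:R * - complex.Re d.
  exists (Num.truncn (hnorm x ^+ 2 / - complex.Re d)).+1.
  by rewrite -ltr_pdivrMr ?oppr_gt0// truncnS_gt.
have := bnd n; lra.
Qed.

End two_isometries.

(** * Compressing a lifting *)

Section subspace_projection.
Variables (R : realType) (H : hilbertType R) (M : closed_subspace H).

Lemma inclP (u : subspace_type M) : subspace_set M (incl u).
Proof. by have := valP u; rewrite /mem_subspace inE. Qed.

Lemma incl_onto x : subspace_set M x -> exists u : subspace_type M, incl u = x.
Proof.
by move=> Mx; have Mx' : mem_subspace M x by [apply/mem_set]; exists (Sub x Mx').
Qed.

Lemma inner_incl (u v : subspace_type M) : inner (incl u) (incl v) = inner u v.
Proof. by []. Qed.

Lemma incl_adj x p : subspace_set M p ->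
  (forall u : subspace_type M, inner (x - p) (incl u) = 0) ->
  incl (adj (incl (M := M)) x) = p.
Proof.
move=> /incl_onto[v <-] xv; congr incl; apply: inner_ext => u.
rewrite -adjP -inner_incl [LHS]innerC [RHS]innerC.
by have := xv u; rewrite innerBl => /eqP; rewrite subr_eq0 => /eqP ->.
Qed.

Lemma incl_adj_id x : subspace_set M x -> incl (adj (incl (M := M)) x) = x.
Proof. by move=> Mx; apply: incl_adj => // u; rewrite subrr inner0l. Qed.

End subspace_projection.

Lemma entries_form (R : realType) (H L : hilbertType R)
    (X : {bounded H -> L}) (W : {bounded L -> L}) (T : {bounded H -> H}) h :
  inner (((adj X \o (Delta W \o X)) \+
          2 \*: Re_op (adj X \o (adj W \o (X \o T)))) h) h =
  inner (W (X h)) (W (X h)) - inner (X h) (X h) +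
  (inner (X (T h)) (W (X h)) + inner (W (X h)) (X (T h))).
Proof.
rewrite [LHS]innerDl/= innerZl/= innerZl mulrA divff ?pnatr_eq0// mul1r innerDl.
rewrite [inner (adj (_ \o _) h) h]innerC -adjP/=.
by rewrite ![inner (adj X _) _]innerC -!adjP -!innerC DeltaE.
Qed.

Section lifting_facts.
Variables (R : realType) (H K : hilbertType R).
Variables (J : {bounded H -> K}) (S : {bounded K -> K}) (T : {bounded H -> H}).
Hypothesis JST : lifting J S T.

Let Ji : isometric J. Proof. by case: JST. Qed.

Let JS k : adj J (S k) = T (adj J k). Proof. by case: JST. Qed.

(** The upper entry of the matrix of [S] maps [h] to [u]. *)
Lemma lifting_split h :
  exists2 u, S (J h) = J (T h) + u & forall k, inner (J k) u = 0.
Proof.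
exists (S (J h) - J (T h)) => [|k]; first by rewrite addrC subrK.
by rewrite adjP linearB/= JS !(isometric_adjK Ji) subrr inner0r.
Qed.

(** With [S (J h) = J (T h) + u], passing from [S] to [T] only loses the squared
    norm of [u]. *)
Lemma compression_dominates (B : {bounded K -> K}) :
  positive_op B -> le_op (Delta S) B ->
  let A : {bounded H -> H} := adj J \o (B \o J) in
  positive_op A /\ le_op (Delta T) A.
Proof.
move=> B0 SB; have AE x y : inner (adj J (B (J x))) y = inner (B (J x)) (J y).
  by rewrite innerC -adjP -innerC.
split=> h; first by rewrite [X in 0 <= X]AE.
rewrite [X in 0 <= X]innerBl [X in _ <= X - _]AE DeltaE.
have := SB (J h); rewrite [X in 0 <= X -> _]innerBl DeltaE (isometric_inner Ji).
have [u -> uJ] := lifting_split h.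
rewrite innerDl !innerDr uJ (innerC u (J _)) uJ rmorph0 (isometric_inner Ji).
rewrite addr0 add0r => /addr_ge0 /(_ (inner_ge0 u)).
by congr (0 <= _); ring.
Qed.

(** Invariance of [range J] under [B] kills the mixed term [<B u, J (T h)>], so
    that the form of [B] at [S (J h) = J (T h) + u] is at least its value at
    [J (T h)]; and that form takes the same value at [S (J h)] and at [J h]. *)
Lemma compression_contraction (B : {bounded K -> K}) :
  positive_op B -> isometry_wrt B S -> leaves_invariant J B ->
  contraction_wrt (adj J \o (B \o J)) T.
Proof.
move=> B0 SB BJ h; rewrite [X in 0 <= X]innerBl/=.
rewrite ![inner (adj _ _) _]innerC -!adjP -!innerC.
have -> : inner (B (J h)) (J h) = inner (B (S (J h))) (S (J h)).
  by rewrite -[in LHS]SB innerC -adjP -innerC.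
have [u -> uJ] := lifting_split h; have [k _ BJk] := BJ (T h).
rewrite [B (_ + _)]linearD/= innerDl !innerDr.
rewrite [inner (B u) (J _)]positive_selfadjoint//.
rewrite -BJk (innerC u (J k)) !uJ rmorph0 addr0 add0r.
by rewrite addrAC subrr add0r.
Qed.

Lemma incl_perp_part (u : subspace_type (perp J)) :
  incl (perp_part J S u) = S (incl u).
Proof.
apply: incl_adj_id => _ [k _ <-]; rewrite innerC adjP JS.
rewrite (_ : adj J (incl u) = 0) ?linear0 ?inner0r ?rmorph0//.
apply: inner_ext => l; rewrite -adjP innerC inner0r.
by rewrite (inclP u) ?rmorph0//; exists l.
Qed.

(** The form of the condition on the entries compares [Delta S] at [S (J h)] and
    at [J (T h)]. For a 2-isometry the first value is also that of [Delta S] at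
    [J h], so the condition says that [T] is a contraction with respect to the
    compression of [Delta S]. *)
Lemma entries_lifting h :
  let W := perp_part J S in let X := perp_entry J S in
  inner (((adj X \o (Delta W \o X)) \+
               2 \*: Re_op (adj X \o (adj W \o (X \o T)))) h) h =
  inner (Delta S (S (J h))) (S (J h)) -
  inner (Delta S (J (T h))) (J (T h)).
Proof.
move=> W X.
have perpP (u : subspace_type (perp J)) k : inner (incl u) (J k) = 0.
  by apply: (inclP u); exists k.
have XE k : S (J k) = J (T k) + incl (X k).
  have [u uE uJ] := lifting_split k.
  rewrite uE; congr (_ + _); apply/esym/incl_adj => [_ [l _ <-]|v].
    by rewrite innerC uJ rmorph0.
  by rewrite /= uE addrK innerC perpP rmorph0.
have Jperp k (u : subspace_type (perp J)) : inner (J k) (incl u) = 0.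
  by rewrite innerC perpP rmorph0.
have XT : inner (incl (X (T h))) (incl (W (X h))) =
    inner (S (J (T h))) (incl (W (X h))).
  by rewrite XE innerDl Jperp add0r.
rewrite entries_form -!inner_incl XT [inner (incl (W _)) (incl (X _))]innerC XT.
rewrite -innerC !incl_perp_part !DeltaE.
have uJ := perpP (X h) (T h); have Ju := Jperp (T h) (X h).
move: (incl (X h)) (XE h) uJ Ju => u -> uJ Ju.
rewrite [S (_ + _)]linearD/= !innerDl !innerDr uJ Ju.
ring.
Qed.

Lemma entries_conditionP : two_isometry S ->
  entries_condition J S T <->
  contraction_wrt (adj J \o (Delta S \o J)) T.
Proof.
move=> /two_isometryP S2; set A : {bounded H -> H} := adj J \o (Delta S \o J).
have E h : inner ((A \- (adj T \o (A \o T))) h) h =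
    inner (Delta S (S (J h))) (S (J h)) - inner (Delta S (J (T h))) (J (T h)).
  rewrite S2 [LHS]innerBl/=.
  by rewrite ![inner (adj _ _) _]innerC -!adjP -!innerC.
split=> [ec h|ct W X h].
  by rewrite [X in 0 <= X]E -entries_lifting; exact: ec.
by rewrite [Y in 0 <= Y]entries_lifting -E; exact: ct.
Qed.

Lemma type_II_contraction : two_isometry S -> type_II J S ->
  contraction_wrt (adj J \o (Delta S \o J)) T.
Proof.
move=> S2 SII; apply: compression_contraction.
- exact: two_isometry_Delta_ge0.
- exact: two_isometry_Delta.
- by move=> h; have [k _ kE] := SII h; exists (k - h); rewrite // linearB/= kE.
Qed.

End lifting_facts.

Section dominated.
Variables (R : realType) (H : hilbertType R).
Hypothesis H_neq0 : exists x : H, x != 0.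

Lemma le_op_refl (A : {bounded H -> H}) : le_op A A.
Proof. by move=> x; rewrite [X in 0 <= X]innerBl subrr. Qed.

(** If [A = 0] then [T] is a contraction, and the identity takes the place of
    [A]; it is nonzero because the space is. *)
Lemma dominated_neq0 (T A : {bounded H -> H}) :
  positive_op A -> contraction_wrt A T -> le_op (Delta T) A ->
  exists A' : {bounded H -> H}, [/\ positive_op A', (exists x, A' x != 0),
        contraction_wrt A' T & le_op (Delta T) A'].
Proof.
move=> A0 AT TA; have [An0|An0] := pselect (exists x, A x != 0).
  by exists A.
have {An0} A0x x : A x = 0.
  by apply/eqP/negPn/negP => Ax; apply: An0; exists x.
have T1 x : inner (T x) (T x) <= inner x x.
  have := TA x; rewrite [X in 0 <= X -> _]innerBl A0x inner0l add0r DeltaE.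
  by rewrite opprB subr_ge0.
exists idfun; split.
- by move=> x; exact: (inner_ge0 x).
- exact: H_neq0.
- move=> x; rewrite [X in 0 <= X]innerBl/= [inner (adj _ _) _]innerC -adjP.
  by rewrite -innerC subr_ge0.
- move=> x; rewrite [X in 0 <= X]innerBl DeltaE opprB addrCA.
  by rewrite addr_ge0 ?inner_ge0// subr_ge0.
Qed.

End dominated.

(** * Minimal liftings *)

Section span.
Variables (R : realType).

Section preimage.
Variables (H K : hilbertType R) (f : {bounded H -> K}) (N : closed_subspace K).

Let pre0 : [set x | subspace_set N (f x)] 0.
Proof. by rewrite /= linear0; exact: subspace_set0. Qed.

Let preP (a : R[i]) x y : [set x | subspace_set N (f x)] x ->
  [set x | subspace_set N (f x)] y ->
  [set x | subspace_set N (f x)] (a *: x + y).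
Proof. by rewrite /= linearP; exact: subspace_setP. Qed.

Let pre_closed : closed [set x | subspace_set N (f x)].
Proof.
apply: (@preimage_closed _ _ f N) => [x _|]; first exact: cts_fun.
exact: subspace_set_closed.
Qed.

Definition preimage_subspace : closed_subspace H :=
  @ClosedSubspace R H [set x | subspace_set N (f x)] pre0 preP pre_closed.

End preimage.

Section closed_span.
Variables (H : hilbertType R) (X : set H).

Let span0 : closed_span X 0.
Proof. by move=> M _; exact: subspace_set0. Qed.

Let spanP (a : R[i]) x y : closed_span X x -> closed_span X y ->
  closed_span X (a *: x + y).
Proof. by move=> Xx Xy M XM; apply: subspace_setP; [exact: Xx|exact: Xy]. Qed.

Let span_closed : closed (closed_span X).
Proof. by apply: closed_bigI => M _; exact: subspace_set_closed. Qed.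

Definition span_subspace : closed_subspace H :=
  @ClosedSubspace R H (closed_span X) span0 spanP span_closed.

Lemma sub_span : X `<=` closed_span X.
Proof. by move=> x Xx M; exact. Qed.

End closed_span.

(** The closed span [M] of the orbits of [range J] is invariant under [S], and
    the restriction of [S] to [M] inherits everything: the type II condition
    because [S^* S J h] already lies in [range J]. A closed subspace of [M] that
    contains the orbits is pulled back to [K] along the projection onto [M] to
    see that it is all of [M]. *)
Lemma minimal_lifting (H K : hilbertType R) (J : {bounded H -> K})
    (S : {bounded K -> K}) (T : {bounded H -> H}) :
  two_isometric_lifting J S T -> type_II J S ->
  exists (K' : hilbertType R) (J' : {bounded H -> K'})
    (S' : {bounded K' -> K'}),
    [/\ two_isometric_lifting J' S' T, type_II J' S' & minimal J' S'].
Proof.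
move=> [S2 [Ji JS]] SII.
pose X : set K := \bigcup_n [set iter n S (J h) | h in [set: H]].
pose M := span_subspace X.
pose J' : {bounded H -> subspace_type M} := adj (incl (M := M)) \o J.
pose S' := compression S M.
have XJ n h : X (iter n S (J h)) by exists n => //; exists h.
have SM x : closed_span X x -> closed_span X (S x).
  move=> Mx N XN; apply: (Mx (preimage_subspace S N)) => _ [n _ [h _ <-]] /=.
  exact: (XN _ (XJ n.+1 h)).
have J'E h : incl (J' h) = J h.
  by apply: incl_adj_id; apply: sub_span; exact: (XJ 0 h).
have S'E u : incl (S' u) = S (incl u).
  by apply: incl_adj_id; apply: SM; exact: (inclP u).
have iterE n h : incl (iter n S' (J' h)) = iter n S (J h).
  by elim: n => [|n IH]; [exact: J'E|rewrite iterS S'E IH].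
exists (subspace_type M), J', S'; split; [split; [|split]| |].
- apply/two_isometryP => u v; rewrite !DeltaE -!inner_incl !S'E.
  have := (two_isometryP S).1 S2 (incl u) (incl v).
  by rewrite !DeltaE.
- by move=> h; rewrite -[LHS]/(`|incl (J' h)|) J'E Ji.
- have adjJ u : adj J' u = adj J (incl u).
    by apply: inner_ext => h; rewrite -!adjP -inner_incl J'E.
  by move=> u; rewrite !adjJ S'E JS.
- move=> h; have [k _ kE] := SII h; exists k => //; apply: inner_ext => u.
  rewrite -[LHS]inner_incl J'E kE -[LHS]adjP -[RHS]adjP.
  by rewrite -[RHS]inner_incl !S'E J'E.
- apply/seteqP; split=> // u _ N XN.
  have := inclP u; move=> /(_ (preimage_subspace (adj (incl (M := M))) N)).
  rewrite /= => h; suff -> : u = adj (incl (M := M)) (incl u).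
    apply: h => _ [n _ [h _ <-]]/=.
    rewrite -iterE (_ : adj _ _ = iter n S' (J' h)); last first.
      by apply: val_inj; apply: incl_adj_id; exact: inclP.
    by apply: XN; exists n => //; exists h.
  by apply: val_inj; apply/esym/incl_adj_id; exact: inclP.
Qed.

End span.

(** * Prepending a coordinate *)

Section l2_cons.
Variables (R : realType) (F : nat -> hilbertType R).

Lemma l2_innerE (f g : l2 F) : inner f g = csum (fun n => inner (f n) (g n)).
Proof. by []. Qed.

Lemma square_summable_tail (f : l2 F) : square_summable (fun n => f n.+1).
Proof.
have [M fM] := coord_l2 f; exists M => n; apply: le_trans (fM n.+1).
by rewrite big_nat_recl// lerDr sqr_ge0.
Qed.

Definition l2_tail (f : l2 F) : l2 (fun n => F n.+1) :=
  L2 (square_summable_tail f).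

Definition cons_coord (x : F 0) (f : l2 (fun n => F n.+1)) n : F n :=
  if n is n.+1 then f n else x.

Lemma square_summable_cons x f : square_summable (cons_coord x f).
Proof.
have [M fM] := coord_l2 f; exists (hnorm x ^+ 2 + M) => -[|n].
  rewrite big_nil addr_ge0 ?sqr_ge0//.
  by have := fM 0; rewrite big_nil.
by rewrite big_nat_recl//= lerD2l.
Qed.

Definition l2_cons x f : l2 F := L2 (square_summable_cons x f).

Lemma l2_consK x f : l2_tail (l2_cons x f) = f.
Proof. exact: l2P. Qed.

Lemma l2_inner_split (f g : l2 F) :
  inner f g = inner (f 0) (g 0) + inner (l2_tail f) (l2_tail g).
Proof. by rewrite !l2_innerE csumS//; exact: csummable_inner. Qed.

Lemma inner_cons x y f g :
  inner (l2_cons x f) (l2_cons y g) = inner x y + inner f g.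
Proof. by rewrite l2_inner_split !l2_consK. Qed.

Lemma l2_cons_lin a x y f g :
  l2_cons (a *: x + y) (a *: f + g) = a *: l2_cons x f + l2_cons y g.
Proof. by apply: l2P => -[|n]; rewrite coordP//= -coordP. Qed.

Lemma l2_tail_lin a (f g : l2 F) :
  l2_tail (a *: f + g) = a *: l2_tail f + l2_tail g.
Proof. by apply: l2P => n; rewrite !coordP /= -coordP. Qed.

End l2_cons.

(** * Factorization of positive operators *)

Section factorization.
Variables (R : realType) (H : hilbertType R).
Implicit Types C : {bounded H -> H}.

(** When [0 <= C <= 1], this is what remains of [C] after subtracting the squares
    of the first [n] terms of the sequence. *)
Fixpoint residual C n : {bounded H -> H} :=
  if n is n.+1 then residual C n \- (residual C n \o residual C n) else C.

(** For [0 <= D <= 1], the identity [D - D^2 = D (1 - D) D + (1 - D) D (1 - D)]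
    shows that [D - D^2] is again positive. *)
Lemma residual_contraction C n : positive_op C -> le_op C idfun ->
  positive_op (residual C n) /\ le_op (residual C n) idfun.
Proof.
move=> C0 C1; elim: n => [//|n [D0 D1]] /=; move: (residual C n) D0 D1 => D D0 D1.
have Dxx x : inner (D x) x - inner (D x) (D x) =
    inner (D x - D (D x)) (D x) + inner (D (x - D x)) (x - D x).
  rewrite [D (x - _)]linearB/= !innerBl !innerBr.
  by rewrite -!(positive_selfadjoint D0 _ x)/=; ring.
split=> x; rewrite [X in 0 <= X]innerBl/=.
  rewrite (positive_selfadjoint D0 (D x)) Dxx.
  by apply: addr_ge0; [exact: D1|exact: D0].
rewrite innerBl opprB addrCA (positive_selfadjoint D0 (D x)).
apply: addr_ge0; first exact: inner_ge0.
by have := D1 x; rewrite [X in 0 <= X -> _]innerBl.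
Qed.

Lemma sum_residual C x n : positive_op C -> le_op C idfun ->
  \sum_(0 <= k < n) hnorm (residual C k x) ^+ 2 =
  complex.Re (inner (C x) x) - complex.Re (inner (residual C n x) x).
Proof.
move=> C0 C1; elim: n => [|n IH]; first by rewrite big_nil subrr.
rewrite big_nat_recr//= IH [in RHS]innerBl/=.
rewrite (positive_selfadjoint (residual_contraction n C0 C1).1 (residual C n x)).
rewrite -Re_innerxx; case: (inner (C x) x) => a b.
case: (inner (residual C n x) x) => c d; case: (inner _ _) => e f /=; ring.
Qed.

Lemma square_summable_residual C x : positive_op C -> le_op C idfun ->
  @square_summable R (fun=> H) (fun n => residual C n x).
Proof.
move=> C0 C1; exists (complex.Re (inner (C x) x)) => n.
rewrite sum_residual// gerBl.
by have := (residual_contraction n C0 C1).1 x; rewrite lecE => /andP[].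
Qed.

Lemma positive_form C x :
  positive_op C -> inner (C x) x = (complex.Re (inner (C x) x))%:C%C.
Proof. by move=> C0; rewrite RRe_real// ger0_real. Qed.

Lemma Re_positive_ge0 C x : positive_op C -> 0 <= complex.Re (inner (C x) x).
Proof. by move=> C0; rewrite -ler0c -positive_form. Qed.

(** The partial sums of the squared norms differ from the form of [C] by the form
    of the residual. This tends to zero: by Cauchy-Schwarz its square is at most
    [|x|^2] times the squared norm of the residual at [x], which is a term of a
    convergent series. *)
Lemma sqnorm_residual C x (C0 : positive_op C) (C1 : le_op C idfun) :
  hnorm (L2 (square_summable_residual x C0 C1)) ^+ 2 =
  complex.Re (inner (C x) x).
Proof.
set f := L2 _; set q := complex.Re _; rewrite l2_hnormE.
have sE n : \sum_(0 <= k < n) hnorm (f k) ^+ 2 =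
    q - complex.Re (inner (residual C n x) x) by exact: sum_residual.
have fq : l2_sqnorm f <= q.
  apply: l2_sqnorm_ub => n; rewrite sE gerBl.
  exact: Re_positive_ge0 (residual_contraction n C0 C1).1.
apply/eqP; rewrite eq_le fq/= -subr_ge0 leNgt subr_lt0; apply/negP => fltq.
have : (q - l2_sqnorm f) ^+ 2 <= 0 * hnorm x ^+ 2.
  have f0 : (fun n => hnorm (f n) ^+ 2 * hnorm x ^+ 2) @ \oo -->
      0 * hnorm x ^+ 2.
    by apply: cvgMr_tmp; apply: cvg_series_cvg_0; exact: cvg_sum_hnorm.
  apply: (cvgr_to_ge f0); apply: nearW => n.
  have h : q - l2_sqnorm f <= complex.Re (inner (residual C n x) x).
    by have := l2_sqnorm_le f n; rewrite sE; lra.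
  rewrite -exprMn ler_sqr ?nnegrE ?mulr_ge0 ?hnorm_ge0//; last by lra.
  apply: le_trans h _; apply: le_trans (ler_norm _) _.
  exact: CauchySchwarz_Re.
by rewrite mul0r leNgt exprn_gt0// subr_gt0.
Qed.

Lemma factor_contraction C : positive_op C -> le_op C idfun ->
  exists X : {bounded H -> l2 (fun=> H)},
    forall x, hnorm (X x) ^+ 2 = complex.Re (inner (C x) x).
Proof.
move=> C0 C1; pose f x : l2 (fun=> H) := L2 (square_summable_residual x C0 C1).
have fL : linear f.
  by move=> a x y; apply: l2P => n; rewrite coordP /= linearP.
have [M M0 CM] := (bounded_hnormP C).2 cts_fun.
have fM x : hnorm (f x) ^+ 2 <= M * hnorm x ^+ 2.
  rewrite sqnorm_residual; apply: le_trans (ler_norm _) _.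
  apply: le_trans (CauchySchwarz_Re _ _) _.
  by rewrite expr2 mulrA ler_wpM2r ?hnorm_ge0 ?CM.
by exists (bounded_op fL fM) => x; exact: sqnorm_residual.
Qed.

(** Once [C] is scaled to a contraction, the sequence of its residuals is the
    factor. It takes the place of the square root of [C], at the price of a
    larger target space. *)
Lemma positive_factor C : positive_op C ->
  exists X : {bounded H -> l2 (fun=> H)},
    forall x y, inner (X x) (X y) = inner (C x) y.
Proof.
move=> C0; have [M M0 CM] := (bounded_hnormP C).2 cts_fun.
have m0 : 0 < M + 1 by rewrite ltr_wpDl.
pose C' : {bounded H -> H} := ((M + 1)^-1)%:C%C \*: C.
have C'E x : inner (C' x) x = ((M + 1)^-1 * complex.Re (inner (C x) x))%:C%C.
  by rewrite [LHS]innerZl positive_form// -rmorphM.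
have C'0 : positive_op C'.
  by move=> x; rewrite C'E ler0c mulr_ge0 ?invr_ge0 ?(ltW m0) ?Re_positive_ge0.
have C'1 : le_op C' idfun.
  move=> x; rewrite [X in 0 <= X]innerBl C'E subr_ge0 inner_normE hnormE.
  rewrite -rmorphXn lecR mulrC ler_pdivrMr//.
  apply: le_trans (ler_norm _) _; apply: le_trans (CauchySchwarz_Re _ _) _.
  have := CM x; have := hnorm_ge0 x; rewrite /=; nra.
have [X' X'E] := factor_contraction C'0 C'1.
pose X : {bounded H -> l2 (fun=> H)} := (Num.sqrt (M + 1))%:C%C \*: X'.
exists X => x y.
have D0 : forall z, ((adj X \o X) \- C) z = 0.
  apply: (form0 (D := (adj X \o X) \- C)) => z.
  rewrite [LHS]innerBl/= [inner (adj _ _) _]innerC -adjP -innerC.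
  apply/eqP; rewrite subr_eq0 positive_form// inner_normE hnormE -rmorphXn.
  rewrite hnormZ ger0_norm ?sqrtr_ge0// exprMn X'E sqr_sqrtr ?ltW//.
  by rewrite C'E/= mulrA divff ?mul1r// gt_eqF.
rewrite [LHS]adjP positive_selfadjoint//; congr (inner x _); apply/eqP.
by rewrite -subr_eq0; apply/eqP; exact: D0.
Qed.

End factorization.

(** * Operator norms and pure isometries *)

Section operator_norm.
Variables (R : realType) (H K : hilbertType R) (f : {bounded H -> K}).

Let has_sup_opnorm : has_sup [set hnorm (f x) | x in [set x | hnorm x <= 1]].
Proof.
have [M M0 fM] := (bounded_hnormP f).2 cts_fun.
split; first by exists (hnorm (f 0)), 0; rewrite //= /hnorm normr0.
by exists M => _ [y /= y1 <-]; apply: le_trans (fM y) _; rewrite ler_piMr.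
Qed.

Lemma opnorm_ge0 : 0 <= opnorm f.
Proof.
apply: sup_upper_bound => //.
by exists 0; rewrite /= ?linear0 /hnorm normr0.
Qed.

Lemma ler_opnorm x : hnorm (f x) <= opnorm f * hnorm x.
Proof.
have [x0|x0] := eqVneq (hnorm x) 0.
  by rewrite (hnorm0_eq0 x0) linear0 /hnorm !normr0 mulr0.
have {}x0 : 0 < hnorm x by rewrite lt_def x0 hnorm_ge0.
rewrite -ler_pdivrMr//; apply: sup_upper_bound => //.
exists ((hnorm x)^-1%:C%C *: x) => /=.
  by rewrite hnormZ ger0_norm ?invr_ge0 ?(ltW x0)// mulVf// gt_eqF.
by rewrite linearZ/= hnormZ ger0_norm ?invr_ge0 ?(ltW x0)// mulrC.
Qed.

Lemma opnorm_le M : 0 <= M -> (forall x, hnorm (f x) <= M * hnorm x) ->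
  opnorm f <= M.
Proof.
move=> M0 fM; apply: ge_sup.
  by exists (hnorm (f 0)), 0; rewrite //= /hnorm normr0.
by move=> _ [y /= y1 <-]; apply: le_trans (fM y) _; rewrite ler_piMr.
Qed.

End operator_norm.

Section pure.
Variables (R : realType) (H : hilbertType R) (U : {bounded H -> H}).

(** On a subspace where [U] is unitary every vector is in the range of all the
    powers of [U]. *)
Lemma pure_isometry_iter : isometric U ->
  (forall x, (forall n, exists y, x = iter n U y) -> x = 0) ->
  pure_isometry U.
Proof.
move=> Ui U0; split=> // M MU [_ MC] x Mx; apply: U0 => n.
suff [y _ yE] : exists2 y, subspace_set M y & x = iter n U y by exists y.
elim: n => [|n [y My yE]]; first by exists x.
have [u uE] := incl_onto My.
exists (incl (adj (compression U M) u)); first exact: inclP.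
rewrite yE iterSr; congr (iter n U _); rewrite -uE -[in LHS](MC u).
by apply: incl_adj_id; exact: (MU _ (inclP _)).1.
Qed.

End pure.

Lemma eq_norm_inner (R : realType) (H K : hilbertType R) (x : H) (y : K) :
  inner x x = inner y y -> `|x| = `|y|.
Proof.
by rewrite !inner_normE => /eqP; rewrite eqrXn2// => /eqP.
Qed.

(** * The lifting attached to a dominating operator *)

Section construction.
Variables (R : realType) (H : hilbertType R).

Definition coeff_space : hilbertType R := l2 (fun=> H).
Definition row_space : hilbertType R := l2 (fun=> coeff_space).
Definition rows n : hilbertType R := if n is 0 then H else row_space.

(** The coordinate 0 carries [H]; the coordinate 1 is the range of [Delta W] and
    the coordinates from 2 on its kernel, where [W] is the part of the lifting
    on the complement of [H]. *)
Definition big_space : hilbertType R := l2 rows.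

Variables (T A : {bounded H -> H}) (X0 X1 : {bounded H -> coeff_space}).
Hypothesis X1E : forall x y,
  inner (X1 x) (X1 y) = inner (A x) y - inner (A (T x)) (T y).
Hypothesis X0E : forall x y, inner (X0 x) (X0 y) =
  inner (A x) y - inner (T x) (T y) + inner x y + inner (A (T x)) (T y).

Let r2 : R[i] := (Num.sqrt 2)%:C%C.

Let row1 (f : big_space) : row_space :=
  @l2_cons R (fun=> coeff_space) (X1 (f 0)) (f 1).
Let row2 (f : big_space) : row_space :=
  @l2_cons R (fun=> coeff_space) (X0 (f 0)) (r2 *: (f 1 : row_space)).

(** In coordinates, with [x & l] for the sequence [l] preceded by [x], the vector
    [(f0, f1, f2, f3, ...)] is mapped to
    [(T f0, X1 f0 & f1, X0 f0 & sqrt 2 f1, f2, f3, ...)]. The coordinate 1 is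
    copied twice, with squared weights 1 and 2, so that it contributes
    [2 |f1|^2] to the form of [Delta], and the same amount after one more step
    as the form of [Delta] looks only at the copy of weight 1. *)
Definition lift_fun (f : big_space) : big_space :=
  @l2_cons R rows (T (f 0))
    (@l2_cons R (fun n => rows n.+1) (row1 f)
       (@l2_cons R (fun n => rows n.+2) (row2 f) (l2_tail (l2_tail f)))).

Lemma inner_big (f g : big_space) : inner f g = inner (f 0) (g 0) +
  (inner (f 1) (g 1) + inner (l2_tail (l2_tail f)) (l2_tail (l2_tail g))).
Proof. by rewrite [LHS]l2_inner_split; congr (_ + _); exact: l2_inner_split. Qed.

(** The two forms of [X0] and [X1] add up to [2 A - Delta T], which together with
    the form of [T] leaves [1 + 2 A] on [H]. *)
Lemma lift_inner f g : inner (lift_fun f) (lift_fun g) =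
  inner f g + 2 * inner (A (f 0)) (g 0) + 2 * inner (f 1) (g 1).
Proof.
have r22 : r2 * r2^* = 2.
  rewrite /r2 conj_Creal ?complex_real//.
  by rewrite -rmorphM -expr2 sqr_sqrtr// rmorph_nat.
have -> : inner (lift_fun f) (lift_fun g) = inner (T (f 0)) (T (g 0)) +
    (inner (row1 f) (row1 g) + (inner (row2 f) (row2 g) +
     inner (l2_tail (l2_tail f)) (l2_tail (l2_tail g)))).
  rewrite [LHS]inner_cons; congr (_ + _).
  by rewrite [LHS]inner_cons; congr (_ + _); exact: inner_cons.
rewrite !inner_cons X1E X0E innerZl innerZr mulrA r22 inner_big.
by ring.
Qed.

Let lift_linear : linear lift_fun.
Proof.
move=> a f g; rewrite /lift_fun.
have c0 : (a *: f + g) 0 = a *: (f 0) + g 0 := coordP 0 a f g.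
have c1 : (a *: f + g) 1 = a *: (f 1) + g 1 := coordP 1 a f g.
have -> : row1 (a *: f + g) = a *: row1 f + row1 g.
  by rewrite /row1 c0 c1 linearP; exact: l2_cons_lin.
have -> : row2 (a *: f + g) = a *: row2 f + row2 g.
  rewrite /row2 c0 c1 linearP scalerDr scalerA mulrC -scalerA.
  exact: l2_cons_lin.
have -> : l2_tail (l2_tail (a *: f + g)) =
    a *: l2_tail (l2_tail f) + l2_tail (l2_tail g).
  by rewrite (l2_tail_lin a f g); exact: l2_tail_lin.
rewrite c0 linearP; apply: etrans (l2_cons_lin _ _ _ _ _).
congr l2_cons; apply: etrans (l2_cons_lin _ _ _ _ _).
by congr l2_cons; exact: l2_cons_lin.
Qed.

Lemma hnorm_big (f : big_space) :
  hnorm (f 0) ^+ 2 + hnorm (f 1) ^+ 2 <= hnorm f ^+ 2.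
Proof.
rewrite -!Re_innerxx inner_big !ReD addrA lerDl.
by rewrite Re_innerxx sqr_ge0.
Qed.

Let lift_bounded f : hnorm (lift_fun f) ^+ 2 <=
  (1 + 2 * opnorm A + 2) * hnorm f ^+ 2.
Proof.
rewrite -Re_innerxx lift_inner !ReD.
have two x : complex.Re (2 * x) = 2 * complex.Re x :> R.
  by case: x => p q; rewrite mulr_natl mulr2n/=; ring.
rewrite !two !Re_innerxx.
have := le_trans (ler_norm _) (CauchySchwarz_Re (A (f 0)) (f 0)).
have := ler_opnorm A (f 0); have := hnorm_big f.
have := hnorm_ge0 (f 0); have := hnorm_ge0 (f 1).
have := opnorm_ge0 A.
set d := opnorm A; set x := hnorm (f 0); set y := hnorm (f 1).
move=> d0 y0 x0 xyf h1 h2.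
have h3 : complex.Re (inner (A (f 0)) (f 0)) <= d * hnorm f ^+ 2.
  by apply: le_trans h2 _; have := sqr_ge0 y; nra.
have := sqr_ge0 x; nra.
Qed.

Definition lift_op : {bounded big_space -> big_space} :=
  bounded_op lift_linear lift_bounded.

Definition base_fun (h : H) : big_space := @l2_cons R rows h 0.

Let base_linear : linear base_fun.
Proof.
by move=> a x y; rewrite /base_fun -l2_cons_lin scaler0 addr0.
Qed.

Let base_inner x y : inner (base_fun x) (base_fun y) = inner x y.
Proof. by rewrite inner_cons inner0l addr0. Qed.

Let base_bounded x : hnorm (base_fun x) ^+ 2 <= 1 * hnorm x ^+ 2.
Proof. by rewrite mul1r -!Re_innerxx base_inner. Qed.

Definition base_op : {bounded H -> big_space} :=
  bounded_op base_linear base_bounded.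

Local Notation S := lift_op.
Local Notation J := base_op.

Lemma inner_base h (f : big_space) : inner (J h) f = inner h (f 0).
Proof. by rewrite l2_inner_split l2_consK inner0l addr0. Qed.

Lemma adj_base f : adj J f = f 0.
Proof. by apply: inner_ext => h; rewrite -adjP inner_base. Qed.

Lemma lift_lifting : lifting J S T.
Proof.
split=> [h|f]; first by apply: eq_norm_inner; exact: base_inner.
by rewrite !adj_base.
Qed.

Lemma Delta_lift_inner f g : inner (Delta S f) g =
  2 * inner (A (f 0)) (g 0) + 2 * inner (f 1) (g 1).
Proof. by rewrite DeltaE [X in X - _]lift_inner; ring. Qed.

Lemma Delta_lift f : Delta S f = @l2_cons R rows (2 *: A (f 0))
  (@l2_cons R (fun n => rows n.+1) (2 *: (f 1 : row_space)) 0).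
Proof.
apply: inner_ext => g; rewrite innerC Delta_lift_inner [RHS]innerC.
congr (_^*); rewrite inner_big innerZl innerZl.
by rewrite (_ : l2_tail _ = 0) ?inner0l ?addr0//; apply: l2P.
Qed.

(** One step of [S] turns the form of [A] at [f 0] into its value at [T (f 0)],
    and [X1] stores the difference in the coordinate 1. *)
Lemma lift_two_isometry : two_isometry S.
Proof.
apply/two_isometryP => f g; rewrite !Delta_lift_inner.
rewrite [inner (S f 1) (S g 1)]inner_cons X1E.
by rewrite (_ : S f 0 = T (f 0))// (_ : S g 0 = T (g 0))//; ring.
Qed.

Lemma lift_type_II : type_II J S.
Proof.
move=> h; exists (h + 2 *: A h) => //.
rewrite -[RHS](subrK (J h)) -[X in _ = X + _]/(Delta S (J h)).
rewrite Delta_lift linearD addrC; congr (_ + _).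
by apply: l2P => -[//|[|n]] /=; rewrite ?scaler0.
Qed.

Lemma perp_base (f : big_space) : subspace_set (perp J) f <-> f 0 = 0.
Proof.
split=> [fJ|f0 _ [h _ <-]].
  apply: inner_ext => h; rewrite -inner_base inner0r innerC.
  by rewrite fJ ?rmorph0//; exists h.
by rewrite innerC inner_base f0 inner0r rmorph0.
Qed.

Let W := perp_part J S.

Let WE u : incl (W u) = S (incl u).
Proof. exact: incl_perp_part lift_lifting u. Qed.

Let u0 (u : subspace_type (perp J)) : incl u 0 = 0.
Proof. exact/perp_base/inclP. Qed.

Let Q (f : big_space) : big_space :=
  @l2_cons R rows 0 (@l2_cons R (fun n => rows n.+1) (f 1) 0).

Let inner_Q f g : inner (Q f) g = inner (f 1) (g 1).
Proof.
rewrite inner_big (_ : l2_tail _ = 0); last exact: l2P.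
by rewrite [inner _ (g 0)]inner0l inner0l addr0 add0r.
Qed.

Let DW_inner u v : inner (Delta W u) v = 2 * inner (incl u 1) (incl v 1).
Proof.
rewrite DeltaE -!inner_incl !WE -DeltaE Delta_lift_inner u0 linear0 inner0l.
by rewrite mulr0 add0r.
Qed.

Let P : {bounded subspace_type (perp J) -> subspace_type (perp J)} :=
  2^-1 \*: Delta W.

Let PE u : incl (P u) = Q (incl u).
Proof.
have [p pE] : exists p : subspace_type (perp J), incl p = Q (incl u).
  by apply: incl_onto; apply/perp_base.
rewrite -pE; congr incl; apply: inner_ext => v; rewrite innerC [RHS]innerC.
congr (_^*); rewrite innerZl DW_inner mulrA mulVf ?pnatr_eq0// mul1r.
by rewrite -[RHS]inner_incl pE inner_Q.
Qed.

Let DWP u : Delta W u = 2 *: P u.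
Proof. by rewrite /= scalerA divff ?pnatr_eq0// scale1r. Qed.

Let P_projection : orth_projection P.
Proof.
split=> u.
  apply: val_inj; rewrite -[LHS]/(incl (P (P u))) -[RHS]/(incl (P u)) !PE.
  by apply: l2P => -[|[|n]].
apply: inner_ext => v; rewrite -adjP -!inner_incl !PE inner_Q.
by rewrite innerC -inner_Q -innerC.
Qed.

Let S_perp (f : big_space) : f 0 = 0 -> f 1 = 0 -> inner (S f) (S f) = inner f f.
Proof.
move=> f0 f1; have := Delta_lift_inner f f.
rewrite DeltaE f0 f1 linear0 !inner0l !mulr0 addr0 => /eqP.
by rewrite subr_eq0 => /eqP.
Qed.

(** On the kernel of [Delta W] the coordinates 0 and 1 vanish and [W] moves each
    of the others one step to the right, so a vector in the range of all the
    powers has no nonzero coordinate. *)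
Lemma canonical_ul_pure : pure_isometry (canonical_ul W).
Proof.
set U := canonical_ul W; set N := nullspace (Delta W) in U *.
have NP (u : subspace_type (perp J)) : subspace_set N u <-> incl u 1 = 0.
  split=> [Du|u1].
    have Pu : P u = 0 by rewrite -[LHS]/(2^-1 *: Delta W u) [Delta W u]Du scaler0.
    have Qu : Q (incl u) = 0 by rewrite -PE Pu linear0.
    by rewrite -[LHS]/(Q (incl u) 1) Qu.
  apply: val_inj; rewrite -[LHS]/(incl (Delta W u)) DWP linearZ/= PE.
  rewrite (_ : Q _ = 0) ?scaler0//.
  by apply: l2P => -[|[|n]] //=.
have z0 (u : subspace_type N) : incl (incl u) 0 = 0 by exact: u0.
have z1 (u : subspace_type N) : incl (incl u) 1 = 0 by exact/NP/inclP.
have UE u : incl (incl (U u)) = S (incl (incl u)).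
  rewrite -WE; congr incl; apply: incl_adj_id; apply/NP; rewrite WE.
  rewrite (_ : S _ 1 = row1 (incl (incl u)))// /row1 z0 z1 linear0.
  by apply: l2P => -[|n].
apply: pure_isometry_iter => [u|u uU].
  apply: eq_norm_inner; rewrite -!inner_incl UE; exact: S_perp.
have iterE n v : incl (incl (iter n U v)) = iter n S (incl (incl v)).
  by elim: n => [//|n IH]; rewrite iterS UE IH.
apply: val_inj; apply: val_inj.
rewrite -[LHS]/(incl (incl u)); apply: l2P => k.
have [v ->] := uU k; rewrite iterE.
have : forall k', (k' < k + 2)%N -> iter k S (incl (incl v)) k' = 0.
  elim: k {uU} => [|k IH] k'; first by case: k' => [|[|]]// _; [exact: z0|exact: z1].
  rewrite iterS; move: (iter k S _) IH => f IH.
  have f0 : f 0 = 0 by apply: IH; rewrite addn2.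
  have f1 : f 1 = 0 by apply: IH; rewrite addn2.
  case: k' => [|[|[|k']]] kk.
  - by rewrite /= f0 linear0.
  - by rewrite /= /row1 f0 f1 linear0; apply: l2P => -[|n].
  - by rewrite /= /row2 f0 f1 linear0 scaler0; apply: l2P => -[|n].
  - by apply: (IH k'.+2); rewrite addSn in kk.
by apply; rewrite addn2 ltnW.
Qed.

(** On the range of [Delta W] only the coordinate 1 remains, and the compression
    of [W] prepends a zero to it. *)
Lemma canonical_dr_pure : pure_isometry (canonical_dr W).
Proof.
set U := canonical_dr W; set M := closure_range (Delta W) in U *.
have MP (u : subspace_type (perp J)) : subspace_set M u <-> P u = u.
  split=> [Mu|Pu]; last first.
    apply: subset_closure; exists (2^-1 *: u) => //.
    by rewrite linearZ.
  have : subspace_set (nullspace (P \- idfun)) u.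
    move: Mu; have /closure_id -> :=
      @subspace_set_closed _ _ (nullspace (P \- idfun)).
    apply: closureS => _ [v _ <-].
    rewrite -[subspace_set _ _]/(P (Delta W v) - Delta W v = 0).
    apply/eqP; rewrite subr_eq0 DWP; apply/eqP.
    by apply: etrans (linearZ _ _) _; congr (2 *: _); exact: P_projection.1.
  move=> h; apply/eqP; rewrite -subr_eq0; apply/eqP; exact: h.
have ME (m : subspace_type M) : incl (incl m) = Q (incl (incl m)).
  by rewrite -PE; congr incl; apply/esym/MP/inclP.
have UE m : incl (incl (U m)) = Q (S (incl (incl m))).
  rewrite -WE -PE; congr incl; apply: incl_adj.
    by apply/MP; exact: P_projection.1.
  move=> v; have <- := (MP _).1 (inclP v).
  rewrite -[P (incl v)]P_projection.2 -adjP.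
  apply: etrans (_ : inner 0 (incl v) = 0); last exact: inner0l.
  congr (inner _ (incl v)); apply: etrans (linearB _ _ _) _.
  by apply/eqP; rewrite subr_eq0; apply/eqP/esym; exact: P_projection.1.
have z0 (m : subspace_type M) : incl (incl m) 0 = 0 by exact: u0.
have S1 (m : subspace_type M) : S (incl (incl m)) 1 =
    @l2_cons R (fun=> coeff_space) 0 (incl (incl m) 1).
  by rewrite -[LHS]/(row1 (incl (incl m))) /row1 z0 linear0.
apply: pure_isometry_iter => [m|m mU].
  apply: eq_norm_inner; rewrite -!inner_incl UE inner_Q.
  rewrite -[RHS]/(inner (incl (incl m)) (incl (incl m))).
  rewrite [in RHS]ME inner_Q -[LHS]/(inner (Q _ 1) (Q _ 1)).
  rewrite -[LHS]/(inner (S (incl (incl m)) 1) (S (incl (incl m)) 1)).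
  by rewrite S1 inner_cons inner0l add0r.
apply: val_inj; apply: val_inj; rewrite -[LHS]/(incl (incl m)) ME.
suff z1 : incl (incl m) 1 = 0 by apply: l2P => -[|[|n]].
apply: l2P => k; have [v ->] := mU k.+1.
have : forall n l, (l < n)%N -> (incl (incl (iter n U v)) 1 : row_space) l = 0.
  elim=> [//|n IH] l; rewrite iterS; move: (iter n U v) IH => z IH ln.
  rewrite UE -[Q _ 1]/(S (incl (incl z)) 1) S1.
  by case: l ln => [//|l]; exact: IH.
by apply.
Qed.

(** [Delta S] is diagonal with entries [2 A], [2] and [0]. The entry [2] is attained
    on the coordinate 1, which is nonzero because [H] is. *)
Lemma cov_lift : (exists x : H, x != 0) ->
  cov S = Num.sqrt 2 * Num.max 1 (Num.sqrt (opnorm A)).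
Proof.
move=> [h h_neq0]; set a := opnorm A; have a0 : 0 <= a := opnorm_ge0 A.
have sq (f : big_space) : hnorm (Delta S f) ^+ 2 =
    (2 * hnorm (A (f 0))) ^+ 2 + (2 * hnorm (f 1)) ^+ 2.
  have hZ (V : hilbertType R) (x : V) : hnorm (2 *: x) = 2 * hnorm x.
    by rewrite -(rmorph_nat (@real_complex R)) hnormZ ger0_norm.
  rewrite -!hZ -!Re_innerxx Delta_lift inner_cons inner_cons inner0l addr0.
  by rewrite ReD.
suff -> : cov S = Num.sqrt (2 * Num.max 1 a).
  rewrite sqrtrM//; congr (_ * _).
  have [a1|a1] := leP 1 a.
    by rewrite max_r// -(sqrtr1 R) ler_sqrt.
  by rewrite max_l ?sqrtr1// -(sqrtr1 R) ler_sqrt// ltW.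
congr Num.sqrt; have m1 : 1 <= Num.max 1 a by rewrite le_max lexx.
have ma : a <= Num.max 1 a by rewrite le_max lexx orbT.
apply/eqP; rewrite eq_le; apply/andP; split.
  apply: opnorm_le => [|f]; first by lra.
  rewrite -ler_sqr ?nnegrE ?mulr_ge0 ?hnorm_ge0//; last by lra.
  rewrite sq; have := ler_opnorm A (f 0); have := hnorm_big f.
  have := hnorm_ge0 (A (f 0)); have := hnorm_ge0 (f 0); rewrite -/a.
  move: (Num.max 1 a) m1 ma => m m1 ma.
  move: (hnorm (f 0)) (hnorm (A (f 0))) => x y x0 y0 xyf yx.
  have h1 : y ^+ 2 <= (m * x) ^+ 2.
    by rewrite ler_sqr ?nnegrE//; nra.
  have h2 : hnorm (f 1) ^+ 2 <= m ^+ 2 * hnorm (f 1) ^+ 2.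
    by rewrite ler_peMl ?sqr_ge0// expr_ge1//; lra.
  have : m ^+ 2 * (x ^+ 2 + hnorm (f 1) ^+ 2) <= m ^+ 2 * hnorm f ^+ 2.
    by rewrite ler_wpM2l ?sqr_ge0.
  rewrite !exprMn in h1 *; nra.
rewrite -ler_pdivlMl// ge_max; apply/andP; split.
  pose e : row_space := @l2_cons R (fun=> coeff_space)
    (@l2_cons R (fun=> H) h 0) 0.
  pose f : big_space := @l2_cons R rows 0 (@l2_cons R (fun n => rows n.+1) e 0).
  have e_neq0 : e != 0.
    apply: contra_neq h_neq0 => e0.
    by rewrite -[h]/((e 0%N : coeff_space) 0%N) e0.
  have fe : hnorm f = hnorm e.
    apply/eqP; rewrite -(@eqrXn2 _ 2) ?hnorm_ge0// -!Re_innerxx.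
    by rewrite inner_cons inner0l add0r inner_cons inner0l addr0.
  have e0 : 0 < hnorm e.
    rewrite lt_def hnorm_ge0 andbT; apply: contra_neq e_neq0.
    exact: hnorm0_eq0.
  have : hnorm (Delta S f) = 2 * hnorm e.
    apply/eqP; rewrite -(@eqrXn2 _ 2) ?mulr_ge0 ?hnorm_ge0// sq.
    by rewrite -[f 0]/(0 : H) linear0 /hnorm normr0/= mulr0 expr0n add0r.
  have := ler_opnorm (Delta S) f; rewrite fe => /[swap] ->.
  by rewrite ler_pM2r// ler_pdivlMl// mulr1.
apply: opnorm_le => [|x]; first by rewrite mulr_ge0 ?opnorm_ge0 ?invr_ge0.
rewrite -mulrA ler_pdivlMl//.
have Jx : hnorm (J x) = hnorm x.
  by apply/eqP; rewrite -(@eqrXn2 _ 2) ?hnorm_ge0// -!Re_innerxx base_inner.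
have : hnorm (Delta S (J x)) = 2 * hnorm (A x).
  apply/eqP; rewrite -(@eqrXn2 _ 2) ?mulr_ge0 ?hnorm_ge0// sq.
  rewrite -[J x 1]/(0 : row_space) -[J x 0]/x.
  by rewrite [hnorm (0 : row_space)]/hnorm normr0/= mulr0 expr0n addr0.
by move=> <-; rewrite -Jx; exact: ler_opnorm.
Qed.

Lemma perp_part_Delta :
  exists2 P, orth_projection P & forall x, Delta W x = 2 *: P x.
Proof. by exists P; [exact: P_projection|exact: DWP]. Qed.

End construction.

Lemma exists_type_II_lifting (R : realType) (H : hilbertType R)
    (T A : {bounded H -> H}) : (exists x : H, x != 0) ->
  positive_op A -> contraction_wrt A T -> le_op (Delta T) A ->
  exists (K : hilbertType R) (J : {bounded H -> K}) (S : {bounded K -> K}),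
    [/\ two_isometric_lifting J S T, type_II J S
      & let W := perp_part J S in
        [/\ (exists2 P, orth_projection P & forall x, Delta W x = 2 *: P x),
            pure_isometry (canonical_ul W), pure_isometry (canonical_dr W)
          & cov S = Num.sqrt 2 * Num.max 1 (Num.sqrt (opnorm A))]].
Proof.
move=> H_neq0 A0 AT TA.
pose C1 : {bounded H -> H} := A \- (adj T \o (A \o T)).
have C1E x y : inner (C1 x) y = inner (A x) y - inner (A (T x)) (T y).
  by rewrite [LHS]innerBl/= [inner (adj _ _) _]innerC -adjP -innerC.
pose C0 : {bounded H -> H} := (A \- Delta T) \+ (adj T \o (A \o T)).
have C0E x y : inner (C0 x) y =
    inner (A x) y - inner (T x) (T y) + inner x y + inner (A (T x)) (T y).
  rewrite [LHS]innerDl [X in X + _ = _]innerBl DeltaE/=.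
  by rewrite [inner (adj _ _) _]innerC -adjP -innerC; ring.
have C0_ge0 : positive_op C0.
  move=> x; rewrite [X in 0 <= X]innerDl; apply: addr_ge0; first exact: TA.
  by rewrite /= innerC -adjP -innerC.
have [X1 X1E] := positive_factor (AT : positive_op C1).
have [X0 X0E] := positive_factor C0_ge0.
have E1 x y : inner (X1 x) (X1 y) = inner (A x) y - inner (A (T x)) (T y).
  by rewrite X1E.
have E0 x y : inner (X0 x) (X0 y) =
    inner (A x) y - inner (T x) (T y) + inner x y + inner (A (T x)) (T y).
  by rewrite X0E.
exists (big_space H), (base_op H), (lift_op E1 E0); split.
- by split; [exact: lift_two_isometry|exact: lift_lifting].
- exact: lift_type_II.
- split.
  + exact: perp_part_Delta.
  + exact: canonical_ul_pure.
  + exact: canonical_dr_pure.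
  + exact: cov_lift.
Qed.

(** * The equivalence *)

Theorem theorem4p1 (R : realType) (H : hilbertType R)
    (H_neq0 : exists x : H, x != 0) (T : {bounded H -> H}) :
  let dominated (A : {bounded H -> H}) :=
    [/\ positive_op A, (exists x, A x != 0),
        contraction_wrt A T & le_op (Delta T) A] in
  let stmt_i :=
    exists (K : hilbertType R) (J : {bounded H -> K}) (S : {bounded K -> K}),
      two_isometric_lifting J S T /\ type_II J S in
  let stmt_ii := exists A : {bounded H -> H}, dominated A in
  let stmt_iii :=
    exists (K : hilbertType R) (J : {bounded H -> K}) (S B : {bounded K -> K}),
      [/\ lifting J S T, positive_op B /\ (exists x, B x != 0),
          isometry_wrt B S, le_op (Delta S) B & leaves_invariant J B] in
  let stmt_iv :=
    exists (K : hilbertType R) (J : {bounded H -> K}) (S : {bounded K -> K}),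
      two_isometric_lifting J S T /\ entries_condition J S T in
  [/\ [<-> stmt_i; stmt_ii; stmt_iii; stmt_iv],
      (stmt_i ->
       exists (K : hilbertType R) (J : {bounded H -> K}) (S : {bounded K -> K}),
         [/\ two_isometric_lifting J S T, type_II J S, entries_condition J S T
           & minimal J S])
    & (forall A : {bounded H -> H}, dominated A ->
       exists (K : hilbertType R) (J : {bounded H -> K}) (S : {bounded K -> K}),
         [/\ two_isometric_lifting J S T, type_II J S, entries_condition J S T
           & let W := perp_part J S in
             [/\ (exists2 P, orth_projection P & forall x, Delta W x = 2 *: P x),
                 pure_isometry (canonical_ul W), pure_isometry (canonical_dr W)
               & cov S = Num.sqrt 2 * Num.max 1 (Num.sqrt (opnorm A))]])].
Proof.
move=> dominated stmt_i stmt_ii stmt_iii stmt_iv.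
have compressed (K : hilbertType R) (J : {bounded H -> K})
    (S B : {bounded K -> K}) : lifting J S T -> positive_op B ->
    le_op (Delta S) B -> contraction_wrt (adj J \o (B \o J)) T -> stmt_ii.
  move=> JST B0 SB BT; have [A0 TA] := compression_dominates JST B0 SB.
  exact: (dominated_neq0 H_neq0 A0 BT TA).
have i_ii : stmt_i -> stmt_ii.
  move=> [K [J [S [[S2 JST] SII]]]].
  apply: (compressed K J S (Delta S)) => //.
  - exact: two_isometry_Delta_ge0.
  - exact: le_op_refl.
  - exact: type_II_contraction.
have iii_ii : stmt_iii -> stmt_ii.
  move=> [K [J [S [B [JST [B0 _] BS SB BJ]]]]].
  apply: (compressed K J S B) => //.
  exact: (compression_contraction JST B0 BS BJ).
have iv_ii : stmt_iv -> stmt_ii.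
  move=> [K [J [S [[S2 JST] Sent]]]].
  apply: (compressed K J S (Delta S)) => //.
  - exact: two_isometry_Delta_ge0.
  - exact: le_op_refl.
  - exact/entries_conditionP.
have entries (K : hilbertType R) (J : {bounded H -> K})
    (S : {bounded K -> K}) : two_isometric_lifting J S T -> type_II J S ->
    entries_condition J S T.
  move=> [S2 JST] SII; apply/entries_conditionP => //.
  exact: type_II_contraction.
have lift A : dominated A -> exists (K : hilbertType R)
    (J : {bounded H -> K}) (S : {bounded K -> K}),
    [/\ two_isometric_lifting J S T, type_II J S, entries_condition J S T
      & let W := perp_part J S in
        [/\ (exists2 P, orth_projection P & forall x, Delta W x = 2 *: P x),
            pure_isometry (canonical_ul W), pure_isometry (canonical_dr W)
          & cov S = Num.sqrt 2 * Num.max 1 (Num.sqrt (opnorm A))]].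
  move=> [A0 _ AT TA].
  have [K [J [S [JST SII SW]]]] := exists_type_II_lifting H_neq0 A0 AT TA.
  by exists K, J, S; split => //; exact: entries.
have ii_iii : stmt_ii -> stmt_iii.
  move=> [A /lift[K [J [S [[S2 JST] SII _ [_ _ _ covS]]]]]].
  exists K, J, S, (Delta S); split => //.
  - split; first exact: two_isometry_Delta_ge0.
    (* The covariance is positive, so [Delta S] is not zero. *)
    apply: contrapT => Delta0; have D0 x : Delta S x = 0.
      by apply: contrapT => /eqP Dx; apply: Delta0; exists x.
    have : 0 < cov S.
      by rewrite covS mulr_gt0 ?sqrtr_gt0// lt_max ltr01.
    rewrite sqrtr_gt0 ltNge => /negP; apply; apply: opnorm_le => // x.
    by rewrite D0 /hnorm normr0 mul0r.
  - exact: two_isometry_Delta.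
  - exact: le_op_refl.
  - move=> h; have [k _ kE] := SII h.
    by exists (k - h); rewrite // linearB/= kE.
have ii_i : stmt_ii -> stmt_i.
  by move=> [A /lift[K [J [S [JST SII _ _]]]]]; exists K, J, S.
have ii_iv : stmt_ii -> stmt_iv.
  by move=> [A /lift[K [J [S [JST _ Sent _]]]]]; exists K, J, S.
split; last exact: lift.
  by tfae; [exact: i_ii|exact: ii_iii|move=> /iii_ii/ii_iv|move=> /iv_ii/ii_i].
move=> [K0 [J0 [S0 [JST0 SII0]]]].
have [K [J [S [JST SII Smin]]]] := minimal_lifting JST0 SII0.
by exists K, J, S; split => //; exact: entries.
Qed.
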